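(* For every $q\in[1,2)$ there are positive constants $C_i=C_i(q)$, $i=1,2,3$, such that for every $d\in\mathbb{N}$, every finite nonempty $Q\subset\mathbb{Z}^d$ and every $m\in\mathbb{N}$ with $m\ge C_1|Q|(\log(2|Q|))^{w(q)}$, where $w(1)=3$ and $w(q)=2$ for $q\in(1,2)$, there exist points $\xi^1,\dots,\xi^m\in\mathbb{T}^d$ such that for all $f\in\mathcal{T}(Q)$ $$C_2\|f\|_q^q\le\frac1m\sum_{j=1}^m|f(\xi^j)|^q\le C_3\|f\|_q^q,$$ i.e. $\mathcal{T}(Q)\in\mathcal{M}(m,q,C_2,C_3)$.
   Context: $\mathbb{T}^d=[0,2\pi)^d$ carries the normalized Lebesgue probability measure and $\|f\|_q=(\int_{\mathbb{T}^d}|f|^qd\mu)^{1/q}$. For finite $Q\subset\mathbb{Z}^d$, $\mathcal{T}(Q)=\{\sum_{\mathbf{k}\in Q}c_{\mathbf{k}}e^{i(\mathbf{k},\mathbf{x})}:c_{\mathbf{k}}\in\mathbb{C}\}$ and $|Q|$ is the cardinality of $Q$. *)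

(* Defs.v *)
From HB Require Import structures.
From mathcomp Require Import all_boot all_order all_algebra.
From mathcomp Require Import all_classical all_reals all_analysis.
From mathcomp Require Import complex finmap.
Set Implicit Arguments. Unset Strict Implicit. Unset Printing Implicit Defensive.
Import Order.TTheory GRing.Theory Num.Theory.
Local Open Scope ring_scope.
Local Open Scope classical_set_scope.
Local Open Scope fset_scope.

Section Torus.
Variable R : realType.

Definition expi (t : R) : R[i] := (cos t +i* sin t)%C.

Definition cabs (z : R[i]) : R := Normc.normc z.

Definition dotZR d (k : 'rV[int]_d) (x : 'rV[R]_d) : R :=
  \sum_(i < d) (k ord0 i)%:~R * x ord0 i.

Definition trig_poly d (Q : {fset 'rV[int]_d}) (c : 'rV[int]_d -> R[i])
  (x : 'rV[R]_d) : R[i] :=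
  \sum_(k <- Q) c k * expi (dotZR k x).

Definition upd d (n : nat) (t : R) (x : 'rV[R]_d) : 'rV[R]_d :=
  \row_j (if (j : nat) == n then t else x ord0 j).

Fixpoint tint_aux d (n : nat) (F : 'rV[R]_d -> R) : R :=
  match n with
  | 0 => F 0
  | n'.+1 => (2 * pi)^-1 *
      Rintegral lebesgue_measure `[0, 2 * pi]
        (fun t => tint_aux n' (fun x => F (upd n' t x)))
  end.

Definition torus_mean d (F : 'rV[R]_d -> R) : R := tint_aux d F.

Definition Lq_pow d (q : R) (f : 'rV[R]_d -> R[i]) : R :=
  torus_mean (fun x => cabs (f x) `^ q).

Definition in_torus d (x : 'rV[R]_d) : Prop :=
  forall j : 'I_d, 0 <= x ord0 j < 2 * pi.

Definition MZ_class d (Q : {fset 'rV[int]_d}) (m : nat) (q C2 C3 : R) : Prop :=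
  exists xi : 'I_m -> 'rV[R]_d,
    (forall j, in_torus (xi j)) /\
    forall c : 'rV[int]_d -> R[i],
      let f := trig_poly Q c in
      C2 * Lq_pow q f <= m%:R^-1 * \sum_(j < m) cabs (f (xi j)) `^ q
      <= C3 * Lq_pow q f.

Definition wexp (q : R) : nat := if q == 1 then 3%N else 2%N.

End Torus.

(* Main.v *)
Require Import Defs.
From HB Require Import structures.
From mathcomp Require Import all_boot all_order all_algebra.
From mathcomp Require Import all_classical all_reals all_analysis.
From mathcomp Require Import complex finmap ring lra.
Import Order.TTheory GRing.Theory Num.Theory numFieldNormedType.Exports.
Local Open Scope ring_scope.

(* Writing a dyadic layer cake sum for [|f|^q], it suffices to control the
   proportion of sample points in the level sets [|g| >= 3 t_k] for [g] in a
   [t_k]-net, in the sup norm, of the unit ball of the [q]-norm.  Since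
   [|f|^2 <= t^(2-q) |f|^q] when [|f| <= t], a cell of the [t_k]-net lies in a
   Euclidean ball, and the dual Sudakov inequality refines it into a
   [t_(k+1)]-net of [exp(C log M 2^(kq))] elements, [M] being the number of
   points where the sup norm is taken.  Chernoff bounds with deviation
   [C log M 2^(kq)] then cost [C |Q| log M] at each of the [O(log |Q|)] levels,
   whence [m >= C |Q| log^2 (2|Q|)] for every [q] in [[1, 2)].  A first crude
   selection replaces the torus by [M = |Q|^O(1)] points.
   The dual Sudakov inequality is proved with random signs instead of Gaussian
   vectors, and the random selections are made one point at a time, keeping an
   exponential potential below 1. *)

Set Implicit Arguments.
Unset Strict Implicit.
Unset Printing Implicit Defensive.

(** * Entropy of Euclidean balls *)

(** Level sets are counted instead of averaging powers because indicators take values in [0, 1] at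
    every height, so a Chernoff bound loses a constant factor and an additive deviation; at height
    [t_k] a deviation proportional to [2 ^ (k q)] is harmless, since the layer cake sum weights it
    by [t_k ^ q]. The entropy has exactly that growth: the squared radius of a cell over the squared
    mesh is of order [t_k ^ (- q)], and with [t_0 ^ q] proportional to the dimension the dimension
    cancels. As [2 ^ q >= 2], the exponents accumulated by successive refinements are dominated by
    the last one, also when [q = 1]. The dual Sudakov bound pays the logarithm of the number of
    functionals, hence the preliminary passage to polynomially many points. That passage must
    preserve the 2-norm along with the [q]-norm, because coefficients are controlled through the
    2-norm. Choosing one point at a time uses only linearity of the mean and the existence of a
    point not much above it, so no product measure on samples is built. *)

Section Cube.
Variables (R : realType) (J : finType).
Implicit Types (y a : {ffun J -> R}) (z : {ffun J -> bool}).

Lemma expR_quadratic (u : R) : u <= 2^-1 -> expR u <= 1 + u + 2 * u ^+ 2.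
Proof.
move=> hu; have h1 : 1 - u <= expR (- u) by exact: expR_ge1Dx.
have h2 : 0 < 1 - u by lra.
have h3 : expR u * expR (- u) = 1 by rewrite -expRD subrr expR0.
have h4 : 0 < expR u by exact: expR_gt0.
have h5 : expR u * (1 - u) <= 1 by rewrite -[leRHS]h3 ler_pM2l.
have h6 : 1 <= (1 + u + 2 * u ^+ 2) * (1 - u).
  have -> : (1 + u + 2 * u ^+ 2) * (1 - u) = 1 + u ^+ 2 * (1 - 2 * u) by ring.
  by rewrite lerDl; apply: mulr_ge0; [exact: sqr_ge0 | lra].
by rewrite -(ler_pM2r h2); apply: le_trans h6.
Qed.

(** The product probability on the sign cube whose [j]-th sign [(-1) ^+ z j] has mean [y j]; it
    plays the role of a Gaussian measure translated by [y]. *)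
Definition tilt y z : R := \prod_j ((1 + y j * (-1) ^+ z j) / 2).

Lemma tilt_ge0 y z : (forall j, `|y j| <= 1) -> 0 <= tilt y z.
Proof.
move=> hy; apply: prodr_ge0 => j _; apply: divr_ge0 => //.
by have := hy j; rewrite ler_norml => /andP[]; case: (z j); rewrite ?expr1 ?expr0; lra.
Qed.

Lemma sum_cube_prod (F : J -> bool -> R) :
  \sum_(z : {ffun J -> bool}) \prod_j F j (z j) = \prod_j (F j true + F j false).
Proof. by rewrite -bigA_distr_bigA; apply: eq_bigr => j _; rewrite big_bool. Qed.

Lemma sum_tilt y : \sum_z tilt y z = 1.
Proof.
rewrite (sum_cube_prod (fun j b => (1 + y j * (-1) ^+ b) / 2)) big1 // => j _.
by rewrite expr0 expr1; lra.
Qed.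

(** The left side is the second moment, under the uniform measure, of the density of the tilted
    measure; it factors into the terms [1 + y j ^+ 2]. *)
Lemma sum_tilt_sqr y :
  \sum_z tilt y z ^+ 2 * 2 ^+ #|J| <= expR (\sum_j y j ^+ 2).
Proof.
rewrite expR_sum.
rewrite [leLHS](_ : _ = \prod_j (1 + y j ^+ 2)); last first.
  transitivity (\prod_j ((((1 + y j * (-1) ^+ true) / 2) ^+ 2 * 2 : R)
      + ((1 + y j * (-1) ^+ false) / 2) ^+ 2 * 2)); last first.
    by apply: eq_bigr => j _; rewrite expr0 expr1; lra.
  rewrite -(sum_cube_prod (fun j b => ((1 + y j * (-1) ^+ b) / 2) ^+ 2 * 2)).
  by apply: eq_bigr => z _; rewrite big_split /= prodr_const -prodrXl.
apply: ler_prod => j _; rewrite addr_ge0 ?sqr_ge0 //=.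
exact: expR_ge1Dx.
Qed.

Lemma sum_tilt_expR y (b : J -> R) :
  (forall j, `|y j| <= 1) -> (forall j, `|b j| <= 4^-1) ->
  \sum_z tilt y z * expR (\sum_j b j * ((-1) ^+ z j - y j))
    <= expR (2 * \sum_j b j ^+ 2).
Proof.
move=> hy hb.
pose F j (c : bool) := (1 + y j * (-1) ^+ c) / 2 * expR (b j * ((-1) ^+ c - y j)).
rewrite [leLHS](_ : _ = \sum_(z : {ffun J -> bool}) \prod_j F j (z j)); last first.
  by apply: eq_bigr => z _; rewrite expR_sum -big_split.
rewrite sum_cube_prod mulr_sumr expR_sum; apply: ler_prod => j _.
have := hy j; have := hb j; rewrite !ler_norml => /andP[b1 b2] /andP[y1 y2].
rewrite /F expr0 expr1; apply/andP; split.
  by apply: addr_ge0; rewrite mulr_ge0 ?expR_ge0 //; lra.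
have h1 : b j * (-1 - y j) <= 2^-1 by nra.
have h2 : b j * (1 - y j) <= 2^-1 by nra.
have := expR_quadratic h1; have := expR_quadratic h2.
set e1 := expR _; set e2 := expR _ => k2 k1.
apply: le_trans (expR_ge1Dx _).
have m1 : (1 + y j * -1) / 2 * e2 <=
    (1 + y j * -1) / 2 * (1 + b j * (-1 - y j) + 2 * (b j * (-1 - y j)) ^+ 2).
  by apply: ler_wpM2l => //; lra.
have m2 : (1 + y j * 1) / 2 * e1 <=
    (1 + y j * 1) / 2 * (1 + b j * (1 - y j) + 2 * (b j * (1 - y j)) ^+ 2).
  by apply: ler_wpM2l => //; lra.
apply: le_trans (lerD m1 m2) _.
(* The linear terms cancel because [y j] is the mean of the sign, and [1 - y j ^+ 2] is its
   variance. *)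
rewrite [leLHS](_ : _ = 1 + 2 * b j ^+ 2 * (1 - y j ^+ 2)); last by field.
have := sqr_ge0 (y j); have := sqr_ge0 (b j); set p := b j ^+ 2; set r := y j ^+ 2.
nra.
Qed.

End Cube.

Section CubePacking.
Variables (R : realType) (J G : finType) (b : G -> J -> R) (n E : R).
Hypotheses (n0 : 0 < n) (E0 : 0 <= E).
Hypothesis hE : 2 * #|G|%:R * expR (- (E ^+ 2 / (8 * n))) <= 2^-1.
Hypothesis hb2 : forall g, \sum_j b g j ^+ 2 <= n.
Hypothesis hb : forall g j, `|E / (4 * n) * b g j| <= 4^-1.
Implicit Types (y : {ffun J -> R}) (z : {ffun J -> bool}).

Let dev y z g : R := \sum_j b g j * ((-1) ^+ z j - y j).

(* The tilted measure concentrates on these points [z]; comparing its second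
   moment with the uniform measure gives them uniform mass at least
   [expR (- \sum_j y j ^+ 2) / 4], while far apart [y] have disjoint ones. *)
Definition near_center y z : bool := [forall g, `|dev y z g| <= E].

(** Chernoff bound and union bound over [g] and the two tails: [l = E / (4 n)] minimizes
    [2 l ^ 2 n - l E], with minimum [- E ^ 2 / (8 n)], and [hE] makes the total at most one half. *)
Lemma tilt_far y : (forall j, `|y j| <= 1) ->
  \sum_(z | ~~ near_center y z) tilt y z <= 2^-1.
Proof.
move=> hy; apply: le_trans hE; set l := E / (4 * n).
have l0 : 0 <= l by rewrite divr_ge0 // mulr_ge0 // ltW.
have lE : l * E - 2 * (l ^+ 2 * n) = E ^+ 2 / (8 * n).
  by rewrite /l; field; rewrite gt_eqF.
have half (e : R) g : e ^+ 2 = 1 ->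
    \sum_z tilt y z * expR (e * l * dev y z g - l * E) <= expR (- (E ^+ 2 / (8 * n))).
  move=> he.
  have he1 : `|e| = 1 by apply/eqP; rewrite -(@eqrXn2 _ 2) // real_normK ?num_real // he expr1n.
  have := @sum_tilt_expR R J y (fun j => e * l * b g j) hy.
  have -> : (forall j, `|e * l * b g j| <= 4^-1) <-> True.
    by split=> // _ j; rewrite -mulrA normrM he1 mul1r; exact: hb.
  move=> /(_ I) h.
  rewrite (eq_bigr (fun z => expR (- (l * E)) *
     (tilt y z * expR (\sum_j e * l * b g j * ((-1) ^+ z j - y j))))); last first.
    move=> z _; rewrite expRD [RHS]mulrC -[RHS]mulrA; congr (_ * (expR _ * _)).
    by rewrite mulr_sumr; apply: eq_bigr => j _; rewrite !mulrA.
  rewrite -mulr_sumr -lE opprB expRD [leRHS]mulrC ler_pM2l ?expR_gt0 //.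
  apply: le_trans h _; rewrite ler_expR ler_pM2l //.
  rewrite (eq_bigr (fun j => l ^+ 2 * b g j ^+ 2)) -?mulr_sumr ?ler_wpM2l ?sqr_ge0 //.
  by move=> j _; rewrite !exprMn he mul1r.
apply: (@le_trans _ _ (\sum_z tilt y z * \sum_g (expR (1 * l * dev y z g - l * E)
     + expR (-1 * l * dev y z g - l * E)))).
  rewrite big_mkcond /=; apply: ler_sum => z _.
  have s0 g : 0 <= expR (1 * l * dev y z g - l * E) + expR (-1 * l * dev y z g - l * E).
    by rewrite addr_ge0 ?expR_ge0.
  case: ifP => [|_]; last by rewrite mulr_ge0 ?tilt_ge0 ?sumr_ge0.
  rewrite negb_forall => /existsP[g]; rewrite -ltNge => /ltW hg.
  rewrite ler_peMr ?tilt_ge0 // (bigD1 g) //=.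
  apply: ler_wpDr; first by rewrite sumr_ge0.
  case: (ger0P (dev y z g)) hg => [_ hg|_ hg].
    apply: ler_wpDr; first exact: expR_ge0.
    rewrite -[leLHS]expR0 ler_expR mul1r -mulrBr mulr_ge0 ?subr_ge0 //.
  apply: ler_wpDl; first exact: expR_ge0.
  by rewrite -[leLHS]expR0 ler_expR mulN1r mulNr -mulrN -mulrBr mulr_ge0 ?subr_ge0 //.
under eq_bigr do rewrite mulr_sumr.
rewrite exchange_big /=.
apply: (@le_trans _ _ (\sum_(g : G) 2 * expR (- (E ^+ 2 / (8 * n))))); last first.
  by rewrite sumr_const -[leLHS]mulr_natr [leLHS]mulrAC.
apply: ler_sum => g _.
under eq_bigr do rewrite mulrDr.
rewrite big_split /= mulr_natl mulr2n; apply: lerD; apply: half.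
  by rewrite expr1n.
by rewrite sqrrN expr1n.
Qed.

Lemma card_near_center y : (forall j, `|y j| <= 1) ->
  expR (- \sum_j y j ^+ 2) * 2 ^+ #|J| <= 4 * #|[pred z | near_center y z]|%:R.
Proof.
move=> hy; set c := expR (\sum_j y j ^+ 2); set N : R := 2 ^+ _.
have N0 : 0 < N by rewrite exprn_gt0.
have c0 : 0 < c by exact: expR_gt0.
have h1 : 2^-1 <= \sum_(z | near_center y z) tilt y z.
  have := sum_tilt y; rewrite (bigID (near_center y)) /=.
  by have := tilt_far hy; lra.
(* AM-GM: t <= t ^ 2 N / (4 c) + c / N. *)
have h2 : \sum_(z | near_center y z) tilt y z <=
    \sum_(z | near_center y z) (tilt y z ^+ 2 * N / (4 * c) + c / N).
  apply: ler_sum => z _; rewrite -subr_ge0.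
  rewrite [leRHS](_ : _ = (tilt y z * N - 2 * c) ^+ 2 / (4 * c * N)); last first.
    by field; rewrite !gt_eqF.
  by rewrite divr_ge0 ?sqr_ge0 // mulr_ge0 ?ltW // mulr_gt0.
move: h2; rewrite big_split /= sumr_const.
have h3 : \sum_(z | near_center y z) tilt y z ^+ 2 * N / (4 * c) <= 4^-1.
  apply: (@le_trans _ _ (\sum_z tilt y z ^+ 2 * N / (4 * c))).
    rewrite [leLHS]big_mkcond /=; apply: ler_sum => z _; case: ifP => // _.
    by apply: divr_ge0; apply: mulr_ge0; rewrite ?sqr_ge0 ?(ltW N0) ?(ltW c0).
  rewrite -mulr_suml ler_pdivrMr ?mulr_gt0 // mulrA mulVf ?mul1r //.
  exact: sum_tilt_sqr.
set k := #|_|; move=> h2.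
have h4 : 4^-1 <= c / N *+ k by lra.
rewrite expRN -/c mulrC ler_pdivrMr //.
move: h4; rewrite -[leRHS]mulr_natr [leRHS]mulrAC ler_pdivlMr //; lra.
Qed.

Definition far_apart (y y' : {ffun J -> R}) : bool :=
  [exists g, 2 * E < `|\sum_j b g j * (y j - y' j)|].

Lemma near_center_disjoint y y' z :
  far_apart y y' -> near_center y z -> ~~ near_center y' z.
Proof.
move=> /existsP[g hg] /forallP/(_ g) h1; apply/forallP => /(_ g) h2.
move: hg; rewrite ltNge => /negP; apply.
have -> : \sum_j b g j * (y j - y' j) = dev y' z g - dev y z g.
  by rewrite /dev -sumrB; apply: eq_bigr => j _; ring.
by apply: le_trans (ler_normB _ _) _; lra.
Qed.

Lemma cube_packing (s : seq {ffun J -> R}) (r : R) :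
  {in s, forall y, (forall j, `|y j| <= 1) /\ \sum_j y j ^+ 2 <= r} ->
  pairwise far_apart s -> (size s)%:R <= 4 * expR r.
Proof.
move=> hs hp; set N : R := 2 ^+ #|J|.
have N0 : 0 < N by rewrite exprn_gt0.
have h1 : \sum_(y <- s) (expR (- r) * N) <= \sum_(y <- s) 4 * #|[pred z | near_center y z]|%:R.
  rewrite big_seq [leRHS]big_seq; apply: ler_sum => y /hs[hy hr].
  by apply: le_trans (card_near_center hy); rewrite ler_pM2r // ler_expR lerN2.
have h2 : \sum_(y <- s) #|[pred z | near_center y z]|%:R <= N.
  rewrite (eq_bigr (fun y => \sum_z (near_center y z)%:R)); last first.
    by move=> y _; rewrite -sum1_card natr_sum /= [LHS]big_mkcond /=; apply: eq_bigr => z _; rewrite inE; case: ifP.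
  rewrite exchange_big /=.
  have -> : N = \sum_(z : {ffun J -> bool}) 1.
    by rewrite sumr_const cardT -cardE card_ffun card_bool natrX.
  apply: ler_sum => z _.
  rewrite -natr_sum -[1]/(1%:R) ler_nat.
  elim: s hp {hs h1} => [|y s IH] /=; first by rewrite big_nil.
  case/andP=> /allP ha /IH h; rewrite big_cons; case: (boolP (near_center y z)) => // hy.
  rewrite big_seq big1 // => y' /ha /near_center_disjoint /(_ hy).
  by case: near_center.
have h3 : (size s)%:R * (expR (- r) * N) <= 4 * N.
  apply: (@le_trans _ _ (\sum_(y <- s) (expR (- r) * N))).
    by rewrite big_const_seq count_predT iter_addr_0 mulr_natl.
  by apply: le_trans h1 _; rewrite -mulr_sumr ler_pM2l.
by move: h3; rewrite mulrA ler_pM2r // expRN ler_pdivrMr ?expR_gt0.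
Qed.

End CubePacking.

Section Covering.
Variables (R : realType) (I G : finType) (a : G -> I -> R).
Hypotheses (I0 : (0 < #|I|)%N) (G0 : (0 < #|G|)%N).
Hypothesis ha : forall g i, `|a g i| <= 1.
Implicit Types x : {ffun I -> R}.

Definition separated (v : R) x x' : bool :=
  [exists g, v < `|\sum_i a g i * (x i - x' i)|].

(** This is [4 * E ^+ 2] for the threshold [E] chosen in [packing]: stretching a separation [v] to
    [2 * E] multiplies squared radii by [4 * E ^+ 2 / v ^+ 2]. *)
Definition entropy_rate : R := 32 * #|I|%:R * ln (4 * #|G|%:R).

Lemma sum_replicate (L : nat) (F : I -> R) :
  \sum_(j : I * 'I_L) F j.1 = L%:R * \sum_i F i.
Proof.
rewrite -(pair_bigA _ (fun i (_ : 'I_L) => F i)) /= mulr_sumr.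
by apply: eq_bigr => i _; rewrite sumr_const card_ord mulr_natl.
Qed.

(* Each coordinate is replicated [L] times with weight [L ^ (-1/2)], which makes
   all entries small without changing inner products. *)
Lemma packing (v r : R) (s : seq {ffun I -> R}) : 0 < v ->
  {in s, forall x, \sum_i x i ^+ 2 <= r} -> pairwise (separated v) s ->
  (size s)%:R <= 4 * expR (entropy_rate * r / v ^+ 2).
Proof.
move=> v0 hs hp; have [s0|] := eqVneq s [::].
  by rewrite s0 mulr_ge0 ?expR_ge0.
rewrite -size_eq0 -lt0n => s0.
have r0 : 0 <= r.
  by apply: le_trans (hs _ (mem_nth 0 s0)); apply: sumr_ge0 => i _; exact: sqr_ge0.
have n0 : 0 < #|I|%:R :> R by rewrite ltr0n.
have g1 : 1 <= #|G|%:R :> R by rewrite ler1n.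
have ln0 : 0 < ln (4 * #|G|%:R) :> R by apply: ln_gt0; lra.
set n : R := #|I|%:R in n0 *.
(* With this [E] the union bound required by [cube_packing] holds with equality. *)
pose E := Num.sqrt (8 * n * ln (4 * #|G|%:R)).
have E2 : E ^+ 2 = 8 * n * ln (4 * #|G|%:R) by rewrite sqr_sqrtr // ltW // !mulr_gt0.
have E0 : 0 < E by rewrite sqrtr_gt0 !mulr_gt0.
pose l := 2 * E / v.
have l0 : 0 < l by rewrite divr_gt0 // mulr_gt0.
(* The first summand brings the replicated coordinates into [-1, 1]; the second brings the
   functional entries under the threshold 1/4 of the exponential moment bound. *)
pose L := (Num.truncn (l ^+ 2 * r + (E / n) ^+ 2)).+1.
have hL : l ^+ 2 * r + (E / n) ^+ 2 <= L%:R by apply: ltW; exact: truncnS_gt.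
pose c : R := Num.sqrt L%:R.
have c0 : 0 < c by rewrite sqrtr_gt0 ltr0n.
have c2 : c ^+ 2 = L%:R by rewrite sqr_sqrtr.
pose y x : {ffun I * 'I_L -> R} := [ffun j => l * x j.1 / c].
pose b g (j : I * 'I_L) := a g j.1 / c.
have hr x : x \in s -> \sum_j y x j ^+ 2 <= l ^+ 2 * r.
  move=> /hs hx.
  rewrite (eq_bigr (fun j : I * 'I_L => (l * x j.1 / c) ^+ 2)); last by move=> j _; rewrite ffunE.
  rewrite (sum_replicate _ (fun i => (l * x i / c) ^+ 2)) -c2 mulr_sumr.
  rewrite (eq_bigr (fun i => l ^+ 2 * x i ^+ 2)) -?mulr_sumr ?ler_wpM2l ?sqr_ge0 //.
  by move=> i _; field; rewrite gt_eqF.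
have -> : entropy_rate * r / v ^+ 2 = l ^+ 2 * r.
  by rewrite /l !exprMn exprVn E2 /entropy_rate -/n; field; rewrite gt_eqF.
rewrite -(size_map y); apply: (@cube_packing R _ G b n E) => //.
- exact: ltW.
- rewrite (_ : E ^+ 2 / _ = ln (4 * #|G|%:R)); last by rewrite E2; field; rewrite gt_eqF.
  rewrite expRN lnK ?posrE; last by lra.
  by rewrite ler_pdivrMr; lra.
- move=> g.
  rewrite (sum_replicate _ (fun i => (a g i / c) ^+ 2)) -c2 mulr_sumr /n -sum1_card natr_sum.
  apply: ler_sum => i _.
  rewrite exprMn mulrCA exprVn divff ?expf_neq0 ?gt_eqF // mulr1 -(expr1n _ 2) -real_normK ?num_real //.
  by rewrite lerXn2r ?nnegrE.
- move=> g j; rewrite /b !normrM; have := ha g j.1; set A := `|a g _| => hA.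
  rewrite !ger0_norm ?invr_ge0 ?mulr_ge0 ?(ltW c0) ?(ltW E0) ?(ltW n0) //.
  have h1 : E / n <= c.
    rewrite -(@ler_pXn2r _ 2) ?nnegrE ?(ltW c0) ?divr_ge0 ?(ltW n0) ?(ltW E0) // c2.
    apply: le_trans hL; rewrite lerDr mulr_ge0 ?sqr_ge0 //.
  have -> : E / (4 * n) * (A / c) = 4^-1 * A * (E / n / c) by field; rewrite !gt_eqF.
  have h2 : E / n / c <= 1 by rewrite ler_pdivrMr // mul1r.
  have h3 : 0 <= E / n / c by rewrite !divr_ge0 ?ltW.
  have A0 : 0 <= A by exact: normr_ge0.
  by nra.
- move=> _ /mapP[x hx ->]; split; last exact: hr.
  move=> j; rewrite -(@ler_pXn2r _ 2) ?nnegrE // expr1n real_normK ?num_real //.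
  rewrite ffunE exprMn exprVn c2 ler_pdivrMr ?ltr0n // mul1r exprMn.
  apply: le_trans hL; apply: ler_wpDr; first exact: sqr_ge0.
  rewrite ler_wpM2l ?sqr_ge0 //; apply: le_trans (hs _ hx).
  by rewrite (bigD1 j.1) //= lerDl sumr_ge0 // => i _; exact: sqr_ge0.
- rewrite pairwise_map; apply: sub_pairwise hp => x x' /existsP[g hg].
  apply/existsP; exists g.
  rewrite (eq_bigr (fun j : I * 'I_L => a g j.1 / c * (l * x j.1 / c - l * x' j.1 / c))); last first.
    by move=> j _; rewrite !ffunE.
  rewrite (sum_replicate _ (fun i => a g i / c * (l * x i / c - l * x' i / c))) -c2 mulr_sumr.
  rewrite (eq_bigr (fun i => l * (a g i * (x i - x' i)))); last first.
    by move=> i _; field; rewrite gt_eqF.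
  rewrite -mulr_sumr normrM gtr0_norm // /l mulrAC ltr_pdivlMr //.
  by rewrite ltr_pM2l // mulr_gt0.
Qed.

(** A separated subset of [S] of maximal size is a net, and its points stay in [S]. The centre [x0]
    is arbitrary because separation depends only on differences. *)
Lemma covering (S : {ffun I -> R} -> Prop) (x0 : {ffun I -> R}) (r v : R) : 0 < v ->
  (forall x, S x -> \sum_i (x i - x0 i) ^+ 2 <= r) ->
  exists s : seq {ffun I -> R}, [/\ forall y, y \in s -> S y,
    forall x, S x -> exists2 y, y \in s & forall g, `|\sum_i a g i * (x i - y i)| <= v &
    (size s)%:R <= 4 * expR (entropy_rate * r / v ^+ 2)].
Proof.
move=> v0 hS.
pose P k := `[< exists s : seq {ffun I -> R}, [/\ size s = k, forall y, y \in s -> S y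
  & pairwise (separated v) s] >].
have bound (s : seq {ffun I -> R}) : (forall y, y \in s -> S y) -> pairwise (separated v) s ->
    (size s)%:R <= 4 * expR (entropy_rate * r / v ^+ 2).
  move=> h1 h2; rewrite -(size_map (fun x : {ffun I -> R} => [ffun i => x i - x0 i])).
  apply: packing => //.
    move=> _ /mapP[x hx ->].
    rewrite (eq_bigr (fun i => (x i - x0 i) ^+ 2)); first by apply: hS; exact: h1.
    by move=> i _; rewrite ffunE.
  rewrite pairwise_map; apply: sub_pairwise h2 => x x' /existsP[g hg]; apply/existsP; exists g.
  by under eq_bigr do rewrite !ffunE opprB addrA subrK.
have exP : exists k, P k by exists 0%N; apply/asboolP; exists [::].
have ubP k : P k -> (k <= Num.truncn (4 * expR (entropy_rate * r / v ^+ 2)))%N.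
  move=> /asboolP[s [<- h1 h2]]; rewrite truncn_ge_nat; first exact: bound.
  by rewrite mulr_ge0 ?expR_ge0.
case: (ex_maxnP exP ubP) => k /asboolP[s [sk h1 h2]] kmax.
exists s; split=> //; last exact: bound.
move=> x hx; have [//|no] := pselect (exists2 y, y \in s & forall g, `|\sum_i a g i * (x i - y i)| <= v).
have : P k.+1.
  apply/asboolP; exists (x :: s); split; first by rewrite /= sk.
    by move=> y; rewrite inE => /orP[/eqP ->|/h1].
  rewrite /= h2 andbT; apply/allP => y ys.
  case: (boolP (separated v x y)) => // hn; case: no; exists y => // g.
  by rewrite leNgt; apply: contra hn => hg; apply/existsP; exists g.
by move/kmax; rewrite ltnn.
Qed.

End Covering.

(** * Selection of sample points *)

Section Selection.
Variables (R : realType) (X : Type) (U : eqType).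
Variables (s : seq U) (D : X -> Prop) (F : U -> X -> R) (mu tau : U -> R).
Hypothesis F01 : forall u x, u \in s -> D x -> 0 <= F u x <= 1.
(* All that is used of the mean [mu]: no linear combination of the [F u] stays
   above its mean on the whole of [D]. *)
Hypothesis exists_below_mean : forall (c : U -> R) (e : R), 0 < e ->
  exists2 x, D x & \sum_(u <- s) c u * F u x < \sum_(u <- s) c u * mu u + e.
Hypothesis tau_small : \sum_(u <- s) 2 * expR (- tau u) < 1.

(** Upper and lower exponential moments of the partial sums [S u] after [m] points. The rates 1 and
    1/3 in front of [m%:R * mu u] come from [expR (f / 2) <= 1 + f] and
    [expR (- (f / 2)) <= 1 - f / 3], and yield the factors 2 and 2/3 of [selection]. *)
Let potential (m : nat) (S : U -> R) : R := \sum_(u <- s)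
  (expR (- tau u) * expR (S u / 2 - m%:R * mu u) + expR (- tau u) * expR (m%:R * mu u / 3 - S u / 2)).

Lemma expR_half_le (f : R) : 0 <= f <= 1 -> expR (f / 2) <= 1 + f.
Proof.
move=> /andP[f0 f1].
have h1 : 1 - f / 2 <= expR (- (f / 2)) by apply: expR_ge1Dx.
have h2 : 0 < expR (f / 2) by exact: expR_gt0.
have h3 : expR (f / 2) * expR (- (f / 2)) = 1 by rewrite -expRD subrr expR0.
have h4 : expR (f / 2) * (1 - f / 2) <= 1 by rewrite -[leRHS]h3 ler_pM2l.
have h5 : 0 < 1 - f / 2 by lra.
by rewrite -(ler_pM2r h5); apply: le_trans h4 _; nra.
Qed.

Lemma expR_half_le_neg (f : R) : 0 <= f <= 1 -> expR (- (f / 2)) <= 1 - f / 3.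
Proof.
move=> /andP[f0 f1].
have h1 : 1 + f / 2 <= expR (f / 2) by apply: expR_ge1Dx.
have h2 : 0 < expR (- (f / 2)) by exact: expR_gt0.
have h3 : expR (- (f / 2)) * expR (f / 2) = 1 by rewrite -expRD addNr expR0.
have h4 : expR (- (f / 2)) * (1 + f / 2) <= 1 by rewrite -[leRHS]h3 ler_pM2l.
have h5 : 0 < 1 + f / 2 by lra.
by rewrite -(ler_pM2r h5); apply: le_trans h4 _; nra.
Qed.

(** The exponentials of [F u x] are first bounded by affine functions, so the new potential is
    dominated by an affine combination of the [F u x]. Replacing each [F u x] by [mu u] gives at
    most the old potential, and [exists_below_mean] is applied with the slack
    [1 - potential m S]. *)
Lemma potential_step (m : nat) (S : U -> R) : potential m S < 1 ->
  exists2 x, D x & potential m.+1 (fun u => F u x + S u) < 1.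
Proof.
move=> h.
pose A u := expR (- tau u) * expR (S u / 2 - m%:R * mu u) * expR (- mu u).
pose B u := expR (- tau u) * expR (m%:R * mu u / 3 - S u / 2) * expR (mu u / 3).
have A0 u : 0 <= A u by rewrite !mulr_ge0 ?expR_ge0.
have B0 u : 0 <= B u by rewrite !mulr_ge0 ?expR_ge0.
have e0 : 0 < 1 - potential m S by rewrite subr_gt0.
have [x Dx hx] := exists_below_mean (fun u => A u - B u / 3) e0.
exists x => //.
have up : potential m.+1 (fun u => F u x + S u) <=
    \sum_(u <- s) (A u + B u) + \sum_(u <- s) (A u - B u / 3) * F u x.
  rewrite -big_split /= /potential [leLHS]big_seq [leRHS]big_seq; apply: ler_sum => u us.
  have hF := F01 us Dx.
  have -> : expR (- tau u) * expR ((F u x + S u) / 2 - m.+1%:R * mu u) = A u * expR (F u x / 2).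
    by rewrite /A -!mulrA -!expRD; congr expR; rewrite -natr1; ring.
  have -> : expR (- tau u) * expR (m.+1%:R * mu u / 3 - (F u x + S u) / 2) = B u * expR (- (F u x / 2)).
    by rewrite /B -!mulrA -!expRD; congr expR; rewrite -natr1; field.
  have h1 := ler_wpM2l (A0 u) (expR_half_le hF).
  have h2 := ler_wpM2l (B0 u) (expR_half_le_neg hF).
  by apply: le_trans (lerD h1 h2) _; lra.
have down : \sum_(u <- s) (A u + B u) + \sum_(u <- s) (A u - B u / 3) * mu u <= potential m S.
  rewrite -big_split /= /potential; apply: ler_sum => u _.
  have h1 : expR (- mu u) * (1 + mu u) <= 1.
    by rewrite mulrC expRN ler_pdivrMr ?expR_gt0 // mul1r expR_ge1Dx.
  have h2 : expR (mu u / 3) * (1 - mu u / 3) <= 1.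
    by rewrite mulrC -ler_pdivlMr ?expR_gt0 // mul1r -expRN expR_ge1Dx.
  have k1 : 0 <= expR (- tau u) * expR (S u / 2 - m%:R * mu u) by rewrite mulr_ge0 ?expR_ge0.
  have k2 : 0 <= expR (- tau u) * expR (m%:R * mu u / 3 - S u / 2) by rewrite mulr_ge0 ?expR_ge0.
  have := ler_wpM2l k1 h1; have := ler_wpM2l k2 h2; rewrite !mulrA -/(A u) -/(B u); lra.
by apply: le_lt_trans up _; lra.
Qed.

Lemma selection (m : nat) : exists2 xi : 'I_m -> X, forall j, D (xi j) &
  forall u, u \in s -> 2 / 3 * (m%:R * mu u) - 2 * tau u <= \sum_(j < m) F u (xi j)
    <= 2 * (m%:R * mu u) + 2 * tau u.
Proof.
have [xi hD hxi] : exists2 xi : 'I_m -> X, forall j, D (xi j) &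
    potential m (fun u => \sum_(j < m) F u (xi j)) < 1.
  elim: m => [|m [xi hD hxi]].
    have x0 : 'I_0 -> X by case.
    exists x0; first by case.
    (* Without any point the moments equal 1, and the potential is the sum bounded in
       [tau_small]. *)
    apply: le_lt_trans tau_small; apply: ler_sum => u _.
    by rewrite big_ord0 !mul0r subrr expR0; lra.
  have [x Dx hx] := potential_step hxi.
  exists (fun j => if unlift ord0 j is Some i then xi i else x).
    by move=> j; case: unliftP.
  congr (_ < _): hx; apply: eq_bigr => u _.
  have -> // : \sum_(j < m.+1) F u (if unlift ord0 j is Some i then xi i else x) =
     F u x + \sum_(j < m) F u (xi j).
  by rewrite big_ord_recl unlift_none; congr (_ + _); apply: eq_bigr => j _; rewrite liftK.
exists xi => // u us.
have t1 : expR (- tau u) * expR ((\sum_(j < m) F u (xi j)) / 2 - m%:R * mu u) +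
          expR (- tau u) * expR (m%:R * mu u / 3 - (\sum_(j < m) F u (xi j)) / 2) < 1.
  apply: le_lt_trans hxi; rewrite /potential (big_rem u) //= lerDl.
  by apply: sumr_ge0 => v _; rewrite addr_ge0 // mulr_ge0 ?expR_ge0.
move: t1; rewrite -!expRD; set p := expR _; set r := expR _ => t1.
have p0 : 0 < p by exact: expR_gt0.
have r0 : 0 < r by exact: expR_gt0.
have : p < 1 by lra.
have : r < 1 by lra.
rewrite /p /r !expR_lt1 => h1 h2.
by apply/andP; split; lra.
Qed.

End Selection.

(** * Real powers and dyadic layer cake sums *)

Section Powers.
Variables (R : realType) (q : R).
Hypothesis hq : 1 <= q <= 2.

Let q0 : 0 <= q. Proof. by case/andP: hq => h _; apply: le_trans h. Qed.

Lemma powR2_bounds : 2 <= (2 : R) `^ q <= 4.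
Proof.
case/andP: hq => h1 h2; apply/andP; split.
  by rewrite -[leLHS]powRr1 // ler_powR // ler1n.
have -> : 4 = 2 `^ 2%:R :> R by rewrite powR_mulrn //; ring.
by rewrite ler_powR // ler1n.
Qed.

Lemma powRD_le (x y : R) : 0 <= x -> 0 <= y -> (x + y) `^ q <= 4 * (x `^ q + y `^ q).
Proof.
have main (u v : R) : 0 <= u -> u <= v -> (u + v) `^ q <= 4 * (u `^ q + v `^ q).
  move=> u0 uv; have v0 := le_trans u0 uv.
  apply: (@le_trans _ _ ((2 * v) `^ q)).
    by apply: ge0_ler_powR; rewrite ?nnegrE ?addr_ge0 ?mulr_ge0 //; lra.
  rewrite powRM //; have := powR2_bounds => /andP[_ h].
  have := powR_ge0 u q; have := powR_ge0 v q; nra.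
move=> x0 y0; have [/main|/ltW/main] := leP x y; first exact.
by rewrite [y + x]addrC [y `^ q + _]addrC; apply.
Qed.

(** By homogeneity: for [u = v r] with [r <= 1], the bounds [v ^ q <= v] and [r ^ 2 <= r ^ q] reduce
    the claim to [1 - r ^ 2 <= 2 (1 - r)]. *)
Lemma powR_sub_le (x y : R) : 0 <= x <= 1 -> 0 <= y <= 1 ->
  `|x `^ q - y `^ q| <= 2 * `|x - y|.
Proof.
have main (u v : R) : 0 <= u -> u <= v -> v <= 1 -> `|u `^ q - v `^ q| <= 2 * `|u - v|.
  move=> u0 uv v1.
  have [v0|v0] := eqVneq v 0.
    have -> : u = 0 by lra.
    by rewrite v0 !subrr normr0 mulr0.
  have {}v0 : 0 < v by lra.
  have h0 : u `^ q <= v `^ q by apply: ge0_ler_powR; rewrite ?nnegrE //; lra.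
  rewrite ler0_norm ?subr_le0 // ler0_norm ?subr_le0 // !opprB.
  have -> : u = v * (u / v) by rewrite mulrCA divff ?gt_eqF // mulr1.
  set r := u / v; have r0 : 0 <= r by rewrite divr_ge0 // ltW.
  have r1 : r <= 1 by rewrite ler_pdivrMr // mul1r.
  rewrite powRM ?(ltW v0) //.
  have h1 : v `^ q <= v by apply: ge1r_powR; [rewrite v0 | case/andP: hq].
  have h2 : r ^+ 2 <= r `^ q.
    have [->|rn] := eqVneq r 0; first by rewrite expr0n powR_ge0.
    by rewrite -powR_mulrn // ger_powR ?lt0r ?rn ?r0 //; case/andP: hq.
  have h3 := powR_ge0 v q.
  have h4 : v `^ q - v `^ q * r `^ q <= v `^ q * (1 - r ^+ 2).
    by rewrite mulrBr mulr1 lerD2l lerN2 ler_wpM2l.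
  apply: le_trans h4 _.
  have h5 : v `^ q * (1 - r ^+ 2) <= v * (1 - r ^+ 2) by apply: ler_wpM2r => //; nra.
  apply: le_trans h5 _.
  have -> : 2 * (v - v * r) = v * (2 * (1 - r)) by ring.
  by apply: ler_wpM2l; [exact: ltW | nra].
move=> /andP[x0 x1] /andP[y0 y1]; have [xy|/ltW xy] := leP x y; first exact: main.
by rewrite distrC (distrC x); exact: main.
Qed.

Lemma sqr_le_powR (t x : R) : 0 <= x <= t -> x ^+ 2 <= t `^ (2 - q) * x `^ q.
Proof.
move=> /andP[x0 xt]; have [->|xn] := eqVneq x 0.
  by rewrite expr0n mulr_ge0 ?powR_ge0.
rewrite -powR_mulrn // -[in leLHS](subrK q 2%:R) powRD; last by rewrite xn implybT.
apply: ler_wpM2r; first exact: powR_ge0.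
by apply: ge0_ler_powR; rewrite ?nnegrE ?(le_trans x0 xt) // subr_ge0; case/andP: hq.
Qed.

Lemma powR_split_sqr (t : R) : 0 < t -> t `^ (2 - q) * t `^ q = t ^+ 2.
Proof.
move=> t0; rewrite -powRD; last by rewrite (gt_eqF t0) implybT.
by rewrite subrK powR_mulrn // ltW.
Qed.

End Powers.

Section LayerCake.
Variables (R : realType) (q theta : R).
Hypotheses (hq : 1 <= q <= 2) (theta0 : 0 < theta).

Definition scale (k : nat) : R := theta / 2 ^+ k.

Lemma scale_gt0 k : 0 < scale k.
Proof. by rewrite divr_gt0 // exprn_gt0. Qed.

Lemma scaleS k : scale k = 2 * scale k.+1.
Proof. by rewrite /scale exprS; field; rewrite expf_neq0. Qed.

Lemma scale_decr j k : (j <= k)%N -> scale k <= scale j.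
Proof.
move=> jk; rewrite /scale ler_pM2l // lef_pV2 ?posrE ?exprn_gt0 //.
by rewrite ler_eXn2l // ltr1n.
Qed.

Lemma scale_powR k : scale k `^ q = theta `^ q / (2 `^ q) ^+ k.
Proof.
elim: k => [|k IH]; first by rewrite /scale !expr0 !divr1.
have := IH; rewrite scaleS powRM ?ltW ?scale_gt0 //.
have h : 2 `^ q != 0 :> R by rewrite gt_eqF // powR_gt0.
move=> h1; apply: (mulfI h); rewrite h1 exprS; field.
by rewrite expf_neq0 // h.
Qed.

Lemma scale_powRS k : scale k `^ q = 2 `^ q * scale k.+1 `^ q.
Proof. by rewrite scaleS powRM // ltW // scale_gt0. Qed.

(** The thresholds [2 * scale k] here and [4 * scale k] in [layer_cake_ge] leave a margin of
    [scale k] on each side of the level [3 * scale k] tested at net points. *)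
Lemma layer_cake_le (u : R) (n : nat) : 0 <= u ->
  \sum_(k < n.+1) scale k `^ q * (2 * scale k <= u)%R%:R <= 2 * u `^ q.
Proof.
move=> u0; have mono k : 2 * scale k <= u -> scale k `^ q <= u `^ q.
  move=> h; have := scale_gt0 k => t0; apply: ge0_ler_powR; rewrite ?nnegrE ?(ltW t0) //.
    by case/andP: hq => h1 _; apply: le_trans h1.
  by lra.
(* Counting the last term twice makes the induction close: a new term is at most half of its
   predecessor, so twice the new term fits in the spare copy. *)
suff: \sum_(k < n.+1) scale k `^ q * (2 * scale k <= u)%R%:R
        + scale n `^ q * (2 * scale n <= u)%R%:R <= 2 * u `^ q.
  by apply: le_trans; rewrite lerDl mulr_ge0 ?powR_ge0.
elim: n => [|n IH].
  rewrite big_ord_recl big_ord0 addr0 /=; case: (boolP (_ <= u)) => [/mono h|_]; first by rewrite mulr1n; lra.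
  by rewrite !mulr0 addr0 mulr_ge0 ?powR_ge0.
rewrite big_ord_recr /=; case: (boolP (2 * scale n.+1 <= u)) => h; last first.
  rewrite big1 ?mulr0 ?addr0 ?mulr_ge0 ?powR_ge0 // => k _.
  suff -> : (2 * scale k <= u) = false by rewrite mulr0.
  apply/negP => h1; move/negP: h; apply; apply: le_trans h1.
  by rewrite ler_pM2l // scale_decr // ltnW.
case: (boolP (2 * scale n <= u)) IH => h1 IH.
  have /andP[h2 _] := powR2_bounds hq.
  have h3 : 2 * scale n.+1 `^ q <= scale n `^ q.
    by rewrite (scale_powRS n) ler_wpM2r ?powR_ge0.
  by move: IH; rewrite !mulr1n; lra.
have -> : \sum_(i < n.+1) scale i `^ q * (2 * scale i <= u)%R%:R = 0.
  apply: big1 => k _.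
  suff -> : (2 * scale k <= u) = false by rewrite mulr0.
  apply/negP => h2; move/negP: h1; apply; apply: le_trans h2.
  by rewrite ler_pM2l // scale_decr // -ltnS.
by have := mono _ h; rewrite mulr1n; lra.
Qed.

(** The first [k] with [4 * scale k <= u] satisfies [u <= 8 * scale k], whence 64; if no level
    qualifies, [u <= 4 * scale n], whence the remainder. *)
Lemma layer_cake_ge (u : R) (n : nat) : 0 <= u <= theta ->
  u `^ q <= 64 * \sum_(k < n.+1) scale k `^ q * (4 * scale k <= u)%R%:R + 16 * scale n `^ q.
Proof.
move=> /andP[u0 ut].
have q0 : 0 <= q by case/andP: hq => h1 _; apply: le_trans h1.
have four : (4 : R) `^ q <= 16.
  have -> : (16 : R) = 4 `^ 2%:R by rewrite powR_mulrn //; ring.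
  by apply: ler_powR; [lra | case/andP: hq].
have small k : u <= 4 * scale k -> u `^ q <= 16 * scale k `^ q.
  have t0 := scale_gt0 k => h; apply: (@le_trans _ _ ((4 * scale k) `^ q)).
    by apply: ge0_ler_powR; rewrite ?nnegrE // mulr_ge0 // ltW.
  by rewrite powRM ?(ltW t0) //; apply: ler_wpM2r => //; exact: powR_ge0.
have nn k : 0 <= \sum_(i < k) scale i `^ q * (4 * scale i <= u)%R%:R.
  by apply: sumr_ge0 => i _; rewrite mulr_ge0 ?powR_ge0.
elim: n => [|n IH].
  apply: le_trans (small 0 _) _; first by rewrite /scale expr0 divr1; lra.
  by rewrite lerDr mulr_ge0 ?nn.
rewrite big_ord_recr /=; case: (boolP (4 * scale n.+1 <= u)) => h; last first.
  apply: le_trans (small n.+1 _) _; first by rewrite -ltNge in h; exact: ltW.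
  by rewrite mulr0 addr0 lerDr mulr_ge0 ?nn.
have /andP[_ h2] := powR2_bounds hq.
have h3 : scale n `^ q <= 4 * scale n.+1 `^ q.
  by rewrite (scale_powRS n) ler_wpM2r ?powR_ge0.
by rewrite mulr1n; have := powR_ge0 (scale n.+1) q; lra.
Qed.

End LayerCake.

(** * Discretization of a finite mean *)

Section Average.
Variables (R : realType) (W : finType).
Hypothesis W0 : (0 < #|W|)%N.
Implicit Types f g : W -> R.

Definition avg f : R := #|W|%:R^-1 * \sum_w f w.

Let card_gt0 : 0 < #|W|%:R :> R. Proof. by rewrite ltr0n. Qed.

Lemma avg_le f g : (forall w, f w <= g w) -> avg f <= avg g.
Proof. by move=> fg; rewrite ler_wpM2l ?invr_ge0 ?(ltW card_gt0) ?ler_sum. Qed.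

Lemma avg_cst (c : R) : avg (fun=> c) = c.
Proof. by rewrite /avg sumr_const cardT -cardE -[c *+ _]mulr_natl mulKf // gt_eqF. Qed.

Lemma avg_ge0 f : (forall w, 0 <= f w) -> 0 <= avg f.
Proof. by move=> f0; rewrite -(avg_cst 0); exact: avg_le. Qed.

Lemma avgD f g : avg (fun w => f w + g w) = avg f + avg g.
Proof. by rewrite /avg big_split mulrDr. Qed.

Lemma avgZ (c : R) f : avg (fun w => c * f w) = c * avg f.
Proof. by rewrite /avg -mulr_sumr mulrCA. Qed.

Lemma avg_sum (U : Type) (s : seq U) (F : U -> W -> R) :
  avg (fun w => \sum_(u <- s) F u w) = \sum_(u <- s) avg (F u).
Proof. by rewrite /avg exchange_big mulr_sumr. Qed.

Lemma avg_below f (e : R) : 0 < e -> exists w, f w < avg f + e.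
Proof.
move=> e0; apply/not_existsP => h.
have : avg (fun=> avg f + e) <= avg f.
  by apply: avg_le => w; rewrite leNgt; apply/negP; exact: h.
rewrite avg_cst; lra.
Qed.

End Average.

Section CauchySchwarz.
Variables (R : realType) (I : finType).
Hypothesis I0 : (0 < #|I|)%N.

Lemma sqr_sum_le (f : I -> R) : (\sum_i f i) ^+ 2 <= #|I|%:R * \sum_i f i ^+ 2.
Proof.
set n : R := #|I|%:R; have n0 : 0 < n by rewrite ltr0n.
set s := \sum_i f i.
have : 0 <= \sum_i (n * f i - s) ^+ 2 by apply: sumr_ge0 => i _; exact: sqr_ge0.
rewrite (eq_bigr (fun i => n ^+ 2 * f i ^+ 2 + (- 2 * n * s) * f i + s ^+ 2)); last first.
  by move=> i _; ring.
rewrite !big_split /= sumr_const cardT -cardE -[s ^+ 2 *+ _]mulr_natl -!mulr_sumr -/s -/n.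
set t := \sum_i _.
have -> : n ^+ 2 * t + - 2 * n * s * s + n * s ^+ 2 = n * (n * t - s ^+ 2) by ring.
by rewrite pmulr_rge0 // subr_ge0.
Qed.

End CauchySchwarz.

(* Seminorms [p w] on coefficient vectors: [p w x] stands for [|f(w)|], and [l]
   gives its real and imaginary parts as functionals with entries at most 1. *)
Record bounded_seminorms (R : realType) (I : finType) (W : Type)
    (l : W * bool -> I -> R) (p : W -> {ffun I -> R} -> R) : Prop := BoundedSeminorms {
  entry_le1 : forall g i, `|l g i| <= 1;
  snorm_ge0 : forall w x, 0 <= p w x;
  snormD : forall w x y, p w (x + y) <= p w x + p w y;
  snormZ : forall w (c : R) (x : {ffun I -> R}), p w [ffun i => c * x i] = `|c| * p w x;
  snorm_le : forall w x, p w x <=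
    `|\sum_i l (w, true) i * x i| + `|\sum_i l (w, false) i * x i| }.

Section SeminormTheory.
Variables (R : realType) (I : finType) (W : Type).
Variables (l : W * bool -> I -> R) (p : W -> {ffun I -> R} -> R).
Hypothesis hp : bounded_seminorms l p.
Implicit Types x y : {ffun I -> R}.

Lemma snormN w x : p w (- x) = p w x.
Proof.
rewrite -[RHS]mul1r -[X in X * _](normrN1 R) -(snormZ hp); congr (p w _).
by apply/ffunP => i; rewrite !ffunE mulN1r.
Qed.

Lemma snormB w x y : p w (x - y) <= p w x + p w y.
Proof. by apply: le_trans (snormD hp _ _ _) _; rewrite snormN. Qed.

Lemma snorm_sub_le w x y : p w x <= p w y + p w (x - y).
Proof. by have := snormD hp w y (x - y); rewrite addrC subrK. Qed.

Lemma snorm0 w : p w 0 = 0.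
Proof.
have -> : 0 = [ffun i => 0 * (0 : {ffun I -> R}) i] by apply/ffunP => i; rewrite !ffunE mul0r.
by rewrite (snormZ hp) normr0 mul0r.
Qed.

Lemma snorm_le_functionals w x (v : R) : (forall g, `|\sum_i l g i * x i| <= v) -> p w x <= 2 * v.
Proof. by move=> h; apply: le_trans (snorm_le hp w x) _; rewrite mulr_natl mulr2n lerD. Qed.

Lemma snorm_le_sum w x : p w x <= 2 * \sum_i `|x i|.
Proof.
apply: snorm_le_functionals => g; apply: le_trans (ler_norm_sum _ _ _) _.
apply: ler_sum => i _; rewrite normrM.
by rewrite ler_piMl ?normr_ge0 // (entry_le1 hp).
Qed.

Lemma snorm_sqr_le w x : (0 < #|I|)%N -> p w x ^+ 2 <= 4 * #|I|%:R * \sum_i x i ^+ 2.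
Proof.
move=> I0; apply: (@le_trans _ _ ((2 * \sum_i `|x i|) ^+ 2)).
  by rewrite lerXn2r ?nnegrE ?mulr_ge0 ?sumr_ge0 ?(snorm_ge0 hp) ?snorm_le_sum.
rewrite exprMn -mulrA -natrX ler_pM2l //.
apply: le_trans (sqr_sum_le I0 _) _.
by under eq_bigr do rewrite real_normK ?num_real //.
Qed.

End SeminormTheory.

(** * Nets of the unit ball of the [q]-norm at dyadic scales *)

Section Nets.
Variables (R : realType) (I W : finType) (q K : R).
Variables (l : W * bool -> I -> R) (p : W -> {ffun I -> R} -> R).
Hypotheses (I0 : (0 < #|I|)%N) (W0 : (0 < #|W|)%N).
Hypotheses (hq : 1 <= q <= 2) (K0 : 0 < K) (hp : bounded_seminorms l p).
Hypothesis hK : forall x : {ffun I -> R}, \sum_i x i ^+ 2 <= K * avg (fun w => p w x ^+ 2).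
Implicit Types x y : {ffun I -> R}.

Definition qmean x : R := avg (fun w => p w x `^ q).

Let q0 : 0 < q. Proof. by case/andP: hq => h _; apply: lt_le_trans h. Qed.

Definition top_scale : R := (4 * K * #|I|%:R) `^ q^-1.
(** The logarithm in [entropy_rate] for the [2 * #|W|] functionals given by real and imaginary
    parts. *)
Definition log_card : R := ln (8 * #|W|%:R).

Let n0 : 0 < #|I|%:R :> R. Proof. by rewrite ltr0n. Qed.

Lemma top_scale_powR : top_scale `^ q = 4 * K * #|I|%:R.
Proof. by rewrite -powRrM mulVf ?gt_eqF // powRr1 // ltW // !mulr_gt0. Qed.

Lemma top_scale_gt0 : 0 < top_scale.
Proof. by rewrite powR_gt0 // !mulr_gt0. Qed.

Lemma log_card_ge : ln 8 <= log_card.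
Proof.
have : 1 <= #|W|%:R :> R by rewrite ler1n.
by move=> h; rewrite ler_ln ?posrE; lra.
Qed.

Lemma log_card_gt0 : 0 < log_card.
Proof. by apply: lt_le_trans log_card_ge; apply: ln_gt0; lra. Qed.

Lemma sqr_sum_bounded x (t : R) : 0 < t -> (forall w, p w x <= t) ->
  \sum_i x i ^+ 2 <= K * (t `^ (2 - q) * qmean x).
Proof.
move=> t0 ht; apply: le_trans (hK x) _; rewrite ler_pM2l // -avgZ; apply: avg_le => // w.
by apply: sqr_le_powR => //; rewrite (snorm_ge0 hp) ht.
Qed.

(** A Nikolskii inequality: at the maximum [t], Cauchy-Schwarz bounds [t ^ 2] by [4 #|I|] times the
    squared coefficient norm, itself at most [K t ^ (2 - q)]; dividing by [t ^ (2 - q)] explains the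
    value of [top_scale]. *)
Lemma snorm_le_top x w : qmean x <= 1 -> p w x <= top_scale.
Proof.
move=> hx; case: (@Order.TotalTheory.arg_maxP _ _ _ w xpredT (fun w => p w x)) => // w' _ hw'.
apply: le_trans (hw' w isT) _; set t := p w' x.
have [t0|t0] := leP t 0; first by apply: le_trans t0 (ltW top_scale_gt0).
have h1 : t ^+ 2 <= 4 * K * #|I|%:R * t `^ (2 - q).
  apply: le_trans (snorm_sqr_le hp w' x I0) _.
  have h2 := sqr_sum_bounded t0 (fun w => hw' w isT).
  have h3 : t `^ (2 - q) * qmean x <= t `^ (2 - q) by rewrite ler_piMr ?powR_ge0.
  have h4 : \sum_i x i ^+ 2 <= K * t `^ (2 - q).
    by apply: le_trans h2 _; rewrite ler_pM2l.
  have -> : 4 * K * #|I|%:R * t `^ (2 - q) = 4 * #|I|%:R * (K * t `^ (2 - q)) by ring.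
  by rewrite ler_pM2l // mulr_gt0.
have h5 : t `^ q <= 4 * K * #|I|%:R.
  by move: h1; rewrite -(powR_split_sqr q t0) mulrC ler_pM2r ?powR_gt0.
rewrite -[t]powRr1 ?(ltW t0) // -(mulfV (lt0r_neq0 q0)) powRrM.
apply: ge0_ler_powR; rewrite ?nnegrE ?invr_ge0 ?powR_ge0 ?(ltW q0) //.
by rewrite ltW // !mulr_gt0.
Qed.

Definition is_net k (s : seq {ffun I -> R}) : Prop := [/\ forall y, y \in s -> qmean y <= 1,
  forall x, qmean x <= 1 -> exists2 y, y \in s & forall w, p w (x - y) <= scale top_scale k &
  (size s)%:R <= expR (1025 * log_card * (2 `^ q) ^+ k)].

Lemma cell_radius k x y : qmean x <= 1 -> qmean y <= 1 ->
  (forall w, p w (x - y) <= scale top_scale k) ->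
  \sum_i (x i - y i) ^+ 2 <= 8 * K * scale top_scale k `^ (2 - q).
Proof.
move=> hx hy hxy; have t0 := scale_gt0 top_scale_gt0 k.
have := sqr_sum_bounded t0 hxy.
rewrite (eq_bigr (fun i => (x i - y i) ^+ 2)); last by move=> i _; rewrite !ffunE.
move=> h; apply: le_trans h _.
have -> : 8 * K * scale top_scale k `^ (2 - q) = K * (scale top_scale k `^ (2 - q) * 8) by ring.
rewrite ler_pM2l // ler_wpM2l ?powR_ge0 //.
apply: (@le_trans _ _ (avg (fun w => 4 * (p w x `^ q + p w y `^ q)))); last first.
  by rewrite avgZ avgD -/(qmean x) -/(qmean y); lra.
apply: avg_le => // w.
apply: le_trans (powRD_le hq (snorm_ge0 hp w x) (snorm_ge0 hp w y)).
apply: ge0_ler_powR; rewrite ?nnegrE ?addr_ge0 ?(snorm_ge0 hp) ?(ltW q0) //.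
exact: (snormB hp).
Qed.

Lemma refine_cell k y : qmean y <= 1 -> exists s : seq {ffun I -> R},
  [/\ forall z, z \in s -> qmean z <= 1,
   forall x, qmean x <= 1 -> (forall w, p w (x - y) <= scale top_scale k) ->
     exists2 z, z \in s & forall w, p w (x - z) <= scale top_scale k.+1 &
   (size s)%:R <= expR (1025 * log_card * (2 `^ q) ^+ k)].
Proof.
move=> hy; have t0 := scale_gt0 top_scale_gt0 k.
have G0 : (0 < #|{: W * bool}|)%N by rewrite card_prod card_bool muln_gt0 W0.
(* A seminorm is at most twice the bound on its two functionals, so a quarter of the scale yields
   half of it, the next scale. *)
have v0 : 0 < scale top_scale k / 4 by rewrite divr_gt0.
have [s [h1 h2 h3]] := covering I0 G0 (entry_le1 hp) v0
  (fun x (hx : qmean x <= 1 /\ forall w, p w (x - y) <= scale top_scale k) =>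
     cell_radius (proj1 hx) hy (proj2 hx)).
exists s; split=> [z /h1[]//|x hx hxy|].
  have [z zs hz] := h2 x (conj hx hxy); exists z => // w.
  apply: (@le_trans _ _ (2 * (scale top_scale k / 4))).
    apply: (snorm_le_functionals hp) => g.
    by rewrite (eq_bigr (fun i => l g i * (x i - z i))) // => i _; rewrite !ffunE.
  by rewrite (scaleS top_scale k); lra.
apply: le_trans h3 _.
(* Dimension and [K] cancel against [top_scale_powR], and [1024 = 32 * 8 * 16 / 4]. The passage to
   1025 then absorbs the factor 4 of [covering]. *)
have -> : entropy_rate R I (W * bool)%type * (8 * K * scale top_scale k `^ (2 - q)) / (scale top_scale k / 4) ^+ 2
    = 1024 * log_card * (2 `^ q) ^+ k.
  rewrite /entropy_rate card_prod card_bool natrM.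
  rewrite [4 * (_ * _)](_ : _ = 8 * #|W|%:R) -/log_card; last by ring.
  rewrite exprMn -(powR_split_sqr q t0) (scale_powR q top_scale_gt0) top_scale_powR.
  field; rewrite !gt_eqF ?exprn_gt0 ?powR_gt0 //.
have a1 : 1 <= ((2 : R) `^ q) ^+ k.
  by rewrite exprn_ege1 //; have /andP[] := powR2_bounds hq; lra.
have L8 := log_card_ge; have L0 := log_card_gt0.
apply: (@le_trans _ _ (8 * expR (1024 * log_card * (2 `^ q) ^+ k))).
  by rewrite ler_pM2r ?expR_gt0 //; lra.
rewrite -[in leLHS](lnK (x := 8)) ?posrE // -expRD ler_expR.
suff : ln 8 <= log_card * (2 `^ q) ^+ k by lra.
by apply: le_trans L8 _; rewrite ler_peMr // ltW.
Qed.

(** The net reached at level [k] and the refinement of each of its cells obey the same size bound.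
    Their product doubles the exponent, and [2 <= 2 ^ q] makes this no more than the exponent of
    level [k + 1]. *)
Lemma exists_net k : exists s, is_net k s.
Proof.
elim: k => [|k [s [hs1 hs2 hs3]]].
  exists [:: 0]; split=> [y|x hx|].
  - rewrite inE => /eqP ->; rewrite /qmean.
    rewrite (_ : (fun w => _) = fun=> 0) ?avg_cst //.
    by apply/funext => w; rewrite (snorm0 hp) powR0 // gt_eqF.
  - exists 0; rewrite ?mem_head // => w; rewrite subr0 /scale expr0 divr1.
    exact: snorm_le_top.
  - apply: le_trans (expR_ge1Dx _); rewrite [X in X <= _](_ : _ = 1) // lerDl.
    by apply: mulr_ge0; [apply: mulr_ge0; [exact: ler0n | exact: ltW log_card_gt0] | rewrite exprn_ge0 ?powR_ge0].
have /choice[N hN] : forall y, exists s', qmean y <= 1 -> [/\ forall z, z \in s' -> qmean z <= 1,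
   forall x, qmean x <= 1 -> (forall w, p w (x - y) <= scale top_scale k) ->
     exists2 z, z \in s' & forall w, p w (x - z) <= scale top_scale k.+1 &
   (size s')%:R <= expR (1025 * log_card * (2 `^ q) ^+ k)].
  move=> y; have [hy|hy] := pselect (qmean y <= 1); last by exists [::].
  by have [s' hs'] := refine_cell k hy; exists s'.
exists (flatten [seq N y | y <- s]); split.
- move=> z /flatten_mapP[y ys zy]; have [h _ _] := hN y (hs1 y ys); exact: h.
- move=> x hx; have [y ys hy] := hs2 x hx; have [_ h _] := hN y (hs1 y ys).
  have [z zN hz] := h x hx hy; exists z => //.
  by apply/flatten_mapP; exists y.
rewrite size_flatten /shape -map_comp sumnE big_map natr_sum.
apply: (@le_trans _ _ ((size s)%:R * expR (1025 * log_card * (2 `^ q) ^+ k))).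
  rewrite mulr_natl -[leRHS]iter_addr_0 -(count_predT s) -big_const_seq.
  rewrite big_seq [leRHS]big_seq; apply: ler_sum => y ys.
  by have [_ _] := hN y (hs1 y ys).
apply: (@le_trans _ _ (expR (1025 * log_card * (2 `^ q) ^+ k) * expR (1025 * log_card * (2 `^ q) ^+ k))).
  by rewrite ler_pM2r ?expR_gt0.
rewrite -expRD ler_expR exprS [leRHS]mulrCA.
have /andP[a2 _] := powR2_bounds hq.
have : 0 <= 1025 * log_card * (2 `^ q) ^+ k.
  by apply: mulr_ge0; [apply: mulr_ge0; [exact: ler0n | exact: ltW log_card_gt0] | rewrite exprn_ge0 ?powR_ge0].
move: (1025 * _ * _) => E E0.
by rewrite -mulr2n -[leLHS]mulr_natl ler_wpM2r.
Qed.

End Nets.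

(** * Sampling a finite mean through all levels *)

Section FiniteDiscretization.
Variables (R : realType) (I W : finType) (q K : R).
Variables (l : W * bool -> I -> R) (p : W -> {ffun I -> R} -> R).
Hypotheses (I0 : (0 < #|I|)%N) (W0 : (0 < #|W|)%N).
Hypotheses (hq : 1 <= q <= 2) (K0 : 0 < K) (hp : bounded_seminorms l p).
Hypothesis hK : forall x : {ffun I -> R}, \sum_i x i ^+ 2 <= K * avg (fun w => p w x ^+ 2).
Implicit Types x y : {ffun I -> R}.

Let q0 : 0 < q. Proof. by case/andP: hq => h _; apply: lt_le_trans h. Qed.
Let n0 : 0 < #|I|%:R :> R. Proof. by rewrite ltr0n. Qed.

Let Lam : R := log_card R W.
Let T : R := 4 * K * #|I|%:R.
Let sc : nat -> R := scale (top_scale I q K).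

Let Lam0 : 0 < Lam. Proof. exact: log_card_gt0. Qed.
Let T0 : 0 < T. Proof. by rewrite !mulr_gt0. Qed.

Lemma ler_bool (b c : bool) : (b -> c) -> b%:R <= c%:R :> R.
Proof. by case: b => [->|_] //; case: c. Qed.

Lemma expR_log_card_le k : expR (- (Lam * (2 `^ q) ^+ k)) <= 4^-1 * 2^-1 ^+ k.
Proof.
have e8 : expR (- Lam) <= 8^-1.
  rewrite expRN lef_pV2 ?posrE ?expR_gt0 //.
  by rewrite -[leLHS](@lnK R) ?posrE // ler_expR log_card_ge.
have e0 := expR_gt0 (- Lam).
have /andP[a2 _] := powR2_bounds hq.
elim: k => [|k IH]; first by rewrite !expr0 !mulr1; lra.
have a1 : 1 <= ((2 : R) `^ q) ^+ k by rewrite exprn_ege1 //; lra.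
apply: (@le_trans _ _ (expR (- (Lam * (2 `^ q) ^+ k)) * expR (- Lam))).
  rewrite -expRD ler_expR -opprD lerN2 -[X in _ + X]mulr1 -mulrDr ler_pM2l // exprS.
  by nra.
have h : 0 < (2^-1 : R) ^+ k by rewrite exprn_gt0.
apply: (@le_trans _ _ (4^-1 * 2^-1 ^+ k * 2^-1)); last by rewrite exprS; lra.
by apply: ler_pM => //; rewrite ?expR_ge0 //; lra.
Qed.

Lemma sum_expR_log_card_lt n : \sum_(k < n) 2 * expR (- (Lam * (2 `^ q) ^+ k)) < 1.
Proof.
suff : \sum_(k < n) 2 * expR (- (Lam * (2 `^ q) ^+ k)) <= 1 - 2^-1 ^+ n.
  by move=> h; apply: le_lt_trans h _; rewrite gtrBl exprn_gt0.
elim: n => [|n IH]; first by rewrite big_ord0 expr0 subrr.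
by rewrite big_ord_recr /= exprS; have := expR_log_card_le n; lra.
Qed.

(* At level [k] the net has at most [expR (1025 Lam 2 ^ (q k))] points, so a
   deviation proportional to [2 ^ (q k)] can be afforded; weighted by
   [scale k ^ q], it contributes the same amount to the layer cake sum at every
   level. *)
Definition level_index (N : nat -> seq {ffun I -> R}) (kk : nat) : seq (nat * {ffun I -> R}) :=
  [seq (k, y) | k <- iota 0 kk.+1, y <- N k].

Definition level_fun (u : nat * {ffun I -> R}) (w : W) : R := (3 * sc u.1 <= p w u.2)%R%:R.

(** Of the 1026 units, 1025 pay for the size of the net and one makes the failure terms summable
    over the levels. *)
Definition level_tau (u : nat * {ffun I -> R}) : R := 1026 * Lam * (2 `^ q) ^+ u.1.

Lemma level_selection (N : nat -> seq {ffun I -> R}) (kk m : nat) :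
  (forall k, is_net q K p k (N k)) ->
  exists xi : 'I_m -> W, forall k y, (k <= kk)%N -> y \in N k ->
    2 / 3 * (m%:R * avg (level_fun (k, y))) - 2 * level_tau (k, y)
      <= \sum_(j < m) level_fun (k, y) (xi j)
      <= 2 * (m%:R * avg (level_fun (k, y))) + 2 * level_tau (k, y).
Proof.
move=> hN.
have F01 u w : u \in level_index N kk -> True -> 0 <= level_fun u w <= 1.
  by move=> _ _; rewrite /level_fun ler0n lern1 leq_b1.
have Fmean (c : nat * {ffun I -> R} -> R) (e : R) : 0 < e -> exists2 w : W, True &
    \sum_(u <- level_index N kk) c u * level_fun u w
      < \sum_(u <- level_index N kk) c u * avg (level_fun u) + e.
  move=> e0; have [w hw] := avg_below W0 (fun w => \sum_(u <- level_index N kk) c u * level_fun u w) e0.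
  exists w => //; apply: lt_le_trans hw _; rewrite avg_sum.
  by under eq_bigr do rewrite avgZ.
have tau1 : \sum_(u <- level_index N kk) 2 * expR (- level_tau u) < 1.
  rewrite big_allpairs_dep (_ : iota 0 kk.+1 = index_iota 0 kk.+1); last by rewrite /index_iota subn0.
  rewrite big_mkord.
  apply: le_lt_trans (sum_expR_log_card_lt kk.+1); apply: ler_sum => k _.
  rewrite (eq_bigr (fun=> 2 * expR (- (1026 * Lam * (2 `^ q) ^+ k)))) //.
  rewrite big_const_seq count_predT iter_addr_0 -[leLHS]mulr_natl mulrCA ler_pM2l //.
  have [_ _ h] := hN k.
  apply: le_trans (ler_wpM2r (expR_ge0 _) h) _.
  by rewrite -expRD ler_expR -/Lam; lra.
have [xi _ hxi] := selection F01 Fmean tau1 m.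
exists xi => k y kk1 yN; apply: hxi.
by apply/allpairsPdep; exists k, y; rewrite mem_iota add0n ltnS.
Qed.

Lemma unit_discretization (N : nat -> seq {ffun I -> R}) (kk m : nat) (xi : 'I_m -> W) x :
  (forall k, is_net q K p k (N k)) ->
  (forall k y, (k <= kk)%N -> y \in N k ->
    2 / 3 * (m%:R * avg (level_fun (k, y))) - 2 * level_tau (k, y)
      <= \sum_(j < m) level_fun (k, y) (xi j)
      <= 2 * (m%:R * avg (level_fun (k, y))) + 2 * level_tau (k, y)) ->
  32 * T <= 2 ^+ kk -> 1000 * (1026 * Lam * T * kk.+1%:R) <= m%:R -> qmean q p x = 1 ->
  m%:R / 800 <= \sum_(j < m) p (xi j) x `^ q <= 300 * m%:R.
Proof.
move=> hN hxi hkk hm hx.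
have /choice[y hy] : forall k, exists y, y \in N k /\ forall w, p w (x - y) <= sc k.
  by move=> k; have [_ h _] := hN k; have [|y yN hy] := h x; [rewrite hx | exists y].
have top0 := top_scale_gt0 q I0 K0.
pose S k : R := sc k `^ q.
have S0 k : 0 <= S k by exact: powR_ge0.
have px w : 0 <= p w x <= top_scale I q K.
  by rewrite (snorm_ge0 hp) (snorm_le_top I0 W0 hq K0 hp hK) // hx.
pose mu k := avg (level_fun (k, y k)); pose C k := \sum_(j < m) level_fun (k, y k) (xi j).
have up k w : (4 * sc k <= p w x)%R%:R <= level_fun (k, y k) w.
  apply: ler_bool => h; have := snorm_sub_le hp w x (y k); have := (hy k).2 w.
  by rewrite /=; lra.
have down k w : level_fun (k, y k) w <= (2 * sc k <= p w x)%R%:R.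
  apply: ler_bool => /= h; have := snorm_sub_le hp w (y k) x; have := (hy k).2 w.
  by rewrite -opprB (snormN hp); lra.
pose E := 1026 * Lam * T * kk.+1%:R.
have sumE : \sum_(k < kk.+1) S k * level_tau (k : nat, y k) = E.
  rewrite (eq_bigr (fun=> 1026 * Lam * T)); last first.
    move=> k _; rewrite /S /sc (scale_powR q top0) top_scale_powR // -/T /level_tau /=.
    by field; rewrite gt_eqF // exprn_gt0 // powR_gt0.
  by rewrite sumr_const card_ord -[LHS]mulr_natr.
have Em : 1000 * E <= m%:R by [].
(* The part below the last level, [16 * S kk], then accounts for at most half of the normalized
   mean. *)
have SK : S kk <= 32^-1.
  rewrite /S /sc (scale_powR q top0) top_scale_powR // -/T ler_pdivrMr ?exprn_gt0 ?powR_gt0 //.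
  have : (2 : R) ^+ kk <= (2 `^ q) ^+ kk.
    by apply: lerXn2r; rewrite ?nnegrE ?powR_ge0 //; case/andP: (powR2_bounds hq).
  lra.
have bounds k : (k <= kk)%N -> 2 / 3 * (m%:R * mu k) - 2 * level_tau (k, y k) <= C k
    <= 2 * (m%:R * mu k) + 2 * level_tau (k, y k).
  by move=> kk1; apply: hxi => //; case: (hy k).
pose A := \sum_(k < kk.+1) S k * mu k; pose B := \sum_(k < kk.+1) S k * C k.
have BA1 : B <= 2 * m%:R * A + 2 * E.
  rewrite -sumE /A !mulr_sumr -big_split /=; apply: ler_sum => k _.
  have /andP[_ h] := bounds k (ltn_ord k).
  by apply: le_trans (ler_wpM2l (S0 k) h) _; rewrite le_eqVlt; apply/orP; left; apply/eqP; ring.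
have BA2 : 2 / 3 * m%:R * A - 2 * E <= B.
  rewrite -sumE /A !mulr_sumr -sumrB /=; apply: ler_sum => k _.
  have /andP[h _] := bounds k (ltn_ord k).
  by apply: le_trans _ (ler_wpM2l (S0 k) h); rewrite le_eqVlt; apply/orP; left; apply/eqP; ring.
have avgA : A = avg (fun w => \sum_(k < kk.+1) S k * level_fun (k : nat, y k) w).
  by rewrite avg_sum; apply: eq_bigr => k _; rewrite avgZ.
have A2 : A <= 2.
  rewrite avgA; apply: (@le_trans _ _ (avg (fun w => 2 * p w x `^ q))).
    apply: avg_le => // w; apply: le_trans (layer_cake_le hq top0 kk (proj1 (andP (px w)))).
    by apply: ler_sum => k _; rewrite ler_wpM2l ?S0 ?up ?down.
  by rewrite avgZ -/(qmean q p x) hx mulr1.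
have A1 : 1 <= 64 * A + 16 * S kk.
  rewrite -[leLHS]hx avgA -avgZ -[16 * _](avg_cst W0) -avgD; apply: avg_le => // w.
  apply: le_trans (layer_cake_ge hq top0 kk (px w)) _; rewrite lerD2r ler_pM2l //.
  by apply: ler_sum => k _; rewrite ler_wpM2l ?S0 ?up ?down.
have B1 : \sum_(j < m) p (xi j) x `^ q <= 64 * B + m%:R * (16 * S kk).
  have -> : m%:R * (16 * S kk) = \sum_(j < m) 16 * S kk.
    by rewrite sumr_const card_ord -[RHS]mulr_natl.
  have -> : B = \sum_(j < m) \sum_(k < kk.+1) S k * level_fun (k : nat, y k) (xi j).
    by rewrite exchange_big; apply: eq_bigr => k _; rewrite mulr_sumr.
  rewrite mulr_sumr -big_split; apply: ler_sum => j _.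
  apply: le_trans (layer_cake_ge hq top0 kk (px _)) _; rewrite lerD2r ler_pM2l //.
  by apply: ler_sum => k _; rewrite ler_wpM2l ?S0 ?up ?down.
have B2 : B <= 2 * \sum_(j < m) p (xi j) x `^ q.
  have -> : B = \sum_(j < m) \sum_(k < kk.+1) S k * level_fun (k : nat, y k) (xi j).
    by rewrite exchange_big; apply: eq_bigr => k _; rewrite mulr_sumr.
  rewrite mulr_sumr; apply: ler_sum => j _.
  apply: le_trans (layer_cake_le hq top0 kk (proj1 (andP (px (xi j))))).
  by apply: ler_sum => k _; rewrite ler_wpM2l ?S0 ?up ?down.
have m0 : 0 <= m%:R :> R by exact: ler0n.
have mA1 : m%:R / 128 <= m%:R * A.
  by apply: ler_wpM2l => //; lra.
have mA2 : m%:R * A <= 2 * m%:R by rewrite mulrC ler_wpM2r.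
have mS : m%:R * (16 * S kk) <= m%:R / 2 by apply: ler_wpM2l => //; lra.
(* Here [1/128 <= A <= 2] and [1000 * E <= m], so [B] lies between [m (1/192 - 1/500)] and
   [m (4 + 1/500)]; [B2] and [B1] turn this into [m / 800] and [300 m]. *)
apply/andP; split; lra.
Qed.

Lemma qmean_ge0 x : 0 <= qmean q p x.
Proof. by apply: avg_ge0 => // w; exact: powR_ge0. Qed.

Lemma finite_discretization (kk m : nat) : (0 < m)%N ->
  32 * (4 * K * #|I|%:R) <= 2 ^+ kk ->
  1000 * (1026 * log_card R W * (4 * K * #|I|%:R) * kk.+1%:R) <= m%:R ->
  exists xi : 'I_m -> W, forall x,
    qmean q p x / 800 <= m%:R^-1 * \sum_(j < m) p (xi j) x `^ q <= 300 * qmean q p x.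
Proof.
move=> m0 hkk hm; have /choice[N hN] := exists_net I0 W0 hq K0 hp hK.
have [xi hxi] := @level_selection N kk m hN.
exists xi => x; have mR : 0 < m%:R :> R by rewrite ltr0n.
have [x0|xn] := eqVneq (qmean q p x) 0.
  rewrite x0 mul0r mulr0 big1 ?mulr0 ?lexx // => j _.
  move/eqP: x0; rewrite /qmean /avg mulf_eq0 invr_eq0 pnatr_eq0 eqn0Ngt W0 /=.
  by rewrite psumr_eq0 => [/allP/(_ (xi j))|i _]; [rewrite mem_index_enum => /(_ isT)/eqP | exact: powR_ge0].
have x0 : 0 < qmean q p x by rewrite lt0r xn qmean_ge0.
set s := qmean q p x in x0 *; pose c := s `^ (- q^-1).
have c0 : 0 < c by exact: powR_gt0.
have cq : c `^ q = s^-1 by rewrite -powRrM mulNr mulVf ?gt_eqF // powR_inv1 // ltW.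
have pc w : p w [ffun i => c * x i] `^ q = s^-1 * p w x `^ q.
  by rewrite (snormZ hp) gtr0_norm // powRM ?(ltW c0) ?(snorm_ge0 hp) // cq.
have h1 : qmean q p [ffun i => c * x i] = 1.
  rewrite /qmean; under eq_fun do rewrite pc.
  by rewrite avgZ mulVf // gt_eqF.
have := unit_discretization hN hxi hkk hm h1.
under eq_bigr do rewrite pc.
rewrite -mulr_sumr ler_pdivlMl // [in X in _ && X]ler_pdivrMl //.
move=> /andP[h2 h3]; apply/andP; split; rewrite ?ler_pdivlMl ?ler_pdivrMl //.
  by apply: le_trans h2; rewrite le_eqVlt; apply/orP; left; apply/eqP; ring.
by apply: le_trans h3 _; rewrite le_eqVlt; apply/orP; left; apply/eqP; ring.
Qed.

End FiniteDiscretization.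

(** * Reduction to polynomially many points *)

(** The interface needed from the torus mean, with [adm] the Lipschitz functions and [D] the
    half-open cube; [mean_below] is the property that provides sample points. *)
Record mean_functional (R : realType) (X : Type) (D : X -> Prop)
    (adm : (X -> R) -> Prop) (mean : (X -> R) -> R) : Prop := MeanFunctional {
  adm_cst : forall c, adm (fun=> c);
  admD : forall f g, adm f -> adm g -> adm (fun x => f x + g x);
  admZ : forall c f, adm f -> adm (fun x => c * f x);
  mean_cst : forall c, mean (fun=> c) = c;
  meanD : forall f g, adm f -> adm g -> mean (fun x => f x + g x) = mean f + mean g;
  meanZ : forall c f, adm f -> mean (fun x => c * f x) = c * mean f;
  mean_le : forall f g, adm f -> adm g -> (forall x, f x <= g x) -> mean f <= mean g;
  mean_below : forall f (e : R), adm f -> 0 < e -> exists2 x, D x & f x < mean f + e }.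

Section MeanTheory.
Variables (R : realType) (X : Type) (D : X -> Prop).
Variables (adm : (X -> R) -> Prop) (mean : (X -> R) -> R).
Hypothesis hm : mean_functional D adm mean.

Lemma adm_lincomb (U : Type) (s : seq U) (c : U -> R) (F : U -> X -> R) :
  (forall u, adm (F u)) -> adm (fun x => \sum_(u <- s) c u * F u x).
Proof.
move=> hF; elim: s => [|u s IH].
  by under eq_fun do rewrite big_nil; exact: adm_cst hm 0.
under eq_fun do rewrite big_cons; apply: (admD hm) IH; exact: admZ hm _ _ (hF u).
Qed.

Lemma mean_lincomb (U : Type) (s : seq U) (c : U -> R) (F : U -> X -> R) :
  (forall u, adm (F u)) ->
  mean (fun x => \sum_(u <- s) c u * F u x) = \sum_(u <- s) c u * mean (F u).
Proof.
move=> hF; elim: s => [|u s IH].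
  by under eq_fun do rewrite big_nil; rewrite big_nil (mean_cst hm).
under eq_fun do rewrite big_cons; rewrite (meanD hm) ?IH ?big_cons ?(meanZ hm) //.
  exact: admZ hm _ _ (hF u).
exact: adm_lincomb.
Qed.

Lemma mean_dist f g (e : R) : adm f -> adm g -> (forall x, `|f x - g x| <= e) ->
  `|mean f - mean g| <= e.
Proof.
have main f1 g1 : adm f1 -> adm g1 -> (forall x, `|f1 x - g1 x| <= e) -> mean f1 - mean g1 <= e.
  move=> af ag h; rewrite lerBlDl -[e in leRHS](mean_cst hm) -(meanD hm) //; last exact: adm_cst hm e.
  apply: (mean_le hm) => //; first exact: admD hm _ _ ag (adm_cst hm e).
  by move=> x; rewrite -lerBlDl; apply: le_trans (h x); exact: ler_norm.
move=> af ag h; rewrite ler_norml lerNl opprB !main // => x.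
by rewrite distrC.
Qed.

End MeanTheory.

Section InitialDiscretization.
Variables (R : realType) (I : finType) (X : Type) (q : R) (D : X -> Prop).
Variables (adm : (X -> R) -> Prop) (mean : (X -> R) -> R).
Variables (l : X * bool -> I -> R) (p : X -> {ffun I -> R} -> R).
Hypotheses (I0 : (0 < #|I|)%N) (hq : 1 <= q <= 2) (hp : bounded_seminorms l p).
Hypothesis hm : mean_functional D adm mean.
Hypothesis p_adm : forall (r : R) x, 1 <= r <= 2 -> adm (fun w => p w x `^ r).
Hypothesis parseval : forall x : {ffun I -> R}, mean (fun w => p w x ^+ 2) = \sum_i x i ^+ 2.
Implicit Types x y : {ffun I -> R}.

Let n : R := #|I|%:R.
Let n0 : 0 < n. Proof. by rewrite ltr0n. Qed.

(** The exponent in the size of [l1_net]; the extra 8 brings the failure sum, for two exponents and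
    two tails, down to [16 * expR (- 8)]. *)
Definition initial_tau : R := 96 * n ^+ 2 * (96 * n) ^+ 2 + 8.

(** This normalization forces all seminorms into [0, 1]. The mesh [delta] changes their powers by at
    most [1 / (24 n)], a sixth of the lower bound [1 / (4 n)] on the means. *)
Let half x : Prop := \sum_i `|x i| = 2^-1.
Let delta : R := (96 * n)^-1.

(** The [l1] norm is the maximum of the functionals given by the sign patterns, so [covering]
    applies with [2 ^ #|I|] functionals, whose logarithm costs only one more factor [n]. *)
Lemma l1_net : exists s : seq {ffun I -> R}, [/\ forall y, y \in s -> half y,
  forall x, half x -> exists2 y, y \in s & \sum_i `|x i - y i| <= delta &
  (size s)%:R <= 4 * expR (96 * n ^+ 2 * (96 * n) ^+ 2)].
Proof.
pose a (g : {ffun I -> bool}) (i : I) : R := (-1) ^+ g i.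
have G0 : (0 < #|{ffun I -> bool}|)%N by rewrite card_ffun card_bool expn_gt0.
have ha g i : `|a g i| <= 1 by rewrite normr_sign.
have d0 : 0 < delta by rewrite invr_gt0 mulr_gt0.
have hr x : half x -> \sum_i (x i - (0 : {ffun I -> R}) i) ^+ 2 <= 1.
  move=> hx; apply: (@le_trans _ _ (\sum_i `|x i|)); last by rewrite hx; lra.
  apply: ler_sum => i _; rewrite ffunE subr0 -real_normK ?num_real //.
  have : `|x i| <= 2^-1.
    by rewrite -hx (bigD1 i) //= lerDl sumr_ge0.
  have := normr_ge0 (x i); nra.
have [s [h1 h2 h3]] := covering I0 G0 ha d0 hr.
exists s; split=> // [x /h2[y ys hy]|].
  exists y => //; apply: le_trans (hy [ffun i => x i - y i < 0]).
  rewrite ger0_norm; last first.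
    by apply: sumr_ge0 => i _; rewrite /a ffunE -normrEsign.
  by apply: ler_sum => i _; rewrite /a ffunE -normrEsign.
apply: le_trans h3 _; rewrite ler_pM2l // ler_expR.
rewrite mulr1 /delta exprVn invrK ler_pM2r ?exprn_gt0 ?mulr_gt0 //.
rewrite /entropy_rate card_ffun card_bool natrX -/n.
have -> : 96 * n ^+ 2 = 32 * n * (3 * n) by ring.
rewrite ler_pM2l ?mulr_gt0 //.
have l2 : ln 2 <= 1 :> R.
  rewrite -[leRHS]expRK ler_ln ?posrE ?expR_gt0 //.
  by apply: le_trans (expR_ge1Dx 1); rewrite -natr1 addrC.
have -> : 4 * 2 ^+ #|I| = 2 ^+ (#|I| + 2) :> R by rewrite exprD mulrC; congr (_ * _); ring.
rewrite lnXn // -[leLHS]mulr_natr natrD -/n.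
have n1 : 1 <= n by rewrite ler1n.
apply: (@le_trans _ _ (1 * (n + 2))); last by lra.
by rewrite ler_wpM2r // addr_ge0 // ltW.
Qed.

Lemma half_snorm x w : half x -> 0 <= p w x <= 1.
Proof.
move=> hx; rewrite (snorm_ge0 hp) /=; apply: le_trans (snorm_le_sum hp w x) _.
by rewrite hx; lra.
Qed.

Lemma snorm_powR2 x : (fun w => p w x `^ 2) = (fun w => p w x ^+ 2).
Proof. by apply/funext => w; rewrite -[2 in LHS]/(2%:R) powR_mulrn // (snorm_ge0 hp). Qed.

(** Seminorms at most 1 have [r]-th powers above their squares; Parseval and Cauchy-Schwarz then
    give the bound. *)
Lemma mean_powR_ge (r : R) x : 1 <= r <= 2 -> half x -> (4 * n)^-1 <= mean (fun w => p w x `^ r).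
Proof.
move=> hr hx; apply: (@le_trans _ _ (\sum_i x i ^+ 2)).
  have := sqr_sum_le I0 (fun i => `|x i|); rewrite hx.
  under eq_bigr do rewrite real_normK ?num_real //.
  rewrite -/n => h; rewrite -[leLHS]mul1r ler_pdivrMr ?mulr_gt0 //; lra.
rewrite -parseval -snorm_powR2; apply: (mean_le hm); try by apply: p_adm; lra.
move=> w; have /andP[p0 p1] := half_snorm w hx.
have [->|pn] := eqVneq (p w x) 0; first by rewrite !powR0 // ?gt_eqF //; lra.
by apply: ger_powR; [rewrite lt0r pn p0 | lra].
Qed.

Lemma powR_snorm_dist (r : R) x y w : 1 <= r <= 2 -> half x -> half y ->
  \sum_i `|x i - y i| <= delta -> `|p w x `^ r - p w y `^ r| <= (24 * n)^-1.
Proof.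
move=> hr hx hy hxy; apply: le_trans (powR_sub_le hr (half_snorm w hx) (half_snorm w hy)) _.
have hd : p w (x - y) <= 2 * delta.
  apply: le_trans (snorm_le_sum hp w _) _; rewrite ler_pM2l //; apply: le_trans hxy.
  by apply: ler_sum => i _; rewrite !ffunE.
have h1 := snorm_sub_le hp w x y; have h2 := snorm_sub_le hp w y x.
have h3 : p w (y - x) = p w (x - y) by rewrite -opprB (snormN hp).
have -> : (24 * n)^-1 = 2 * (2 * delta) by rewrite /delta; field; rewrite gt_eqF.
by rewrite ler_pM2l // ler_norml; apply/andP; split; lra.
Qed.

Lemma initial_discretization (M : nat) : (0 < M)%N -> 48 * n * initial_tau <= M%:R ->
  exists2 xi : 'I_M -> X, forall j, D (xi j) & forall (r : R) x, (r = q) \/ (r = 2) ->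
    mean (fun w => p w x `^ r) / 4 <= avg (fun j => p (xi j) x `^ r)
      <= 4 * mean (fun w => p w x `^ r).
Proof.
move=> M0 hM; have MR : 0 < M%:R :> R by rewrite ltr0n.
have M0' : (0 < #|'I_M|)%N by rewrite card_ord.
have [s [hs1 hs2 hs3]] := l1_net.
pose ex (b : bool) : R := if b then q else 2.
have hex b : 1 <= ex b <= 2 by case: b => //=; lra.
pose idx : seq ({ffun I -> R} * bool) := [seq (y, b) | y <- s, b <- [:: true; false]].
pose F (u : {ffun I -> R} * bool) w := p w u.1 `^ ex u.2.
have Fadm u : adm (F u) by exact: p_adm.
have F01 u w : u \in idx -> D w -> 0 <= F u w <= 1.
  move=> /allpairsP[[y b] [/= ys _ ->]] _; have /andP[p0 p1] := half_snorm w (hs1 y ys).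
  rewrite powR_ge0 /=; apply: (@le_trans _ _ (1 `^ ex b)); last by rewrite powR1.
  by apply: ge0_ler_powR; rewrite ?nnegrE //; have := hex b; lra.
have Fmean (c : {ffun I -> R} * bool -> R) (e : R) : 0 < e -> exists2 w, D w &
    \sum_(u <- idx) c u * F u w < \sum_(u <- idx) c u * mean (F u) + e.
  move=> e0; have [w Dw hw] := mean_below hm (adm_lincomb hm idx c Fadm) e0.
  by exists w => //; rewrite -(mean_lincomb hm).
have tau1 : \sum_(u <- idx) 2 * expR (- initial_tau) < 1.
  rewrite big_const_seq count_predT iter_addr_0 size_allpairs /= -[ltLHS]mulr_natl natrM.
  rewrite /initial_tau; move: hs3; set z := _ * (96 * n) ^+ 2 => hs3; rewrite opprD expRD.
  have e2 : 2 <= expR 1 :> R by apply: le_trans (expR_ge1Dx 1); lra.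
  have e8 : expR (- 8) * 256 <= 1 :> R.
    rewrite expRN mulrC ler_pdivrMr ?expR_gt0 // mul1r.
    rewrite -[8 in leRHS]mulr1 expRM_natl.
    apply: (@le_trans _ _ (2 ^+ 8)); first by rewrite -natrX ler_nat.
    by apply: lerXn2r; rewrite ?nnegrE ?expR_ge0.
  have h0 : (size s)%:R * expR (- z) <= 4.
    by rewrite expRN ler_pdivrMr ?expR_gt0.
  have e0 := expR_gt0 (- 8 : R).
  rewrite [ltLHS](_ : _ = (size s)%:R * expR (- z) * (4 * expR (- 8))); last by ring.
  apply: (@le_lt_trans _ _ (4 * (4 * expR (- 8)))); last by lra.
  by apply: ler_wpM2r => //; lra.
have [xi hD hxi] := selection F01 Fmean tau1 M.
exists xi => // r x hr.
have [b {hr}->] : exists b, r = ex b by case: hr => ->; [exists true | exists false].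
have unit x1 : half x1 -> mean (fun w => p w x1 `^ ex b) / 4 <= avg (fun j => p (xi j) x1 `^ ex b)
      <= 4 * mean (fun w => p w x1 `^ ex b).
  move=> hx; have [y ys hy] := hs2 x1 hx; have hy1 := hs1 y ys.
  have m1 := mean_powR_ge (hex b) hx; have m2 := mean_powR_ge (hex b) hy1.
  have dm : `|mean (fun w => p w x1 `^ ex b) - mean (fun w => p w y `^ ex b)| <= (24 * n)^-1.
    by apply: (mean_dist hm) => [||w]; [exact: p_adm|exact: p_adm|exact: powR_snorm_dist].
  have da1 : avg (fun j => p (xi j) x1 `^ ex b) <= avg (fun j => p (xi j) y `^ ex b) + (24 * n)^-1.
    rewrite -[X in _ + X](avg_cst M0') -avgD; apply: avg_le => // j.
    have := powR_snorm_dist (xi j) (hex b) hx hy1 hy; rewrite ler_norml; lra.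
  have da2 : avg (fun j => p (xi j) y `^ ex b) <= avg (fun j => p (xi j) x1 `^ ex b) + (24 * n)^-1.
    rewrite -[X in _ + X](avg_cst M0') -avgD; apply: avg_le => // j.
    have := powR_snorm_dist (xi j) (hex b) hx hy1 hy; rewrite ler_norml; lra.
  have ui : (y, b) \in idx by apply/allpairsP; exists (y, b); split=> //; case: (b).
  have := hxi _ ui; rewrite /F /=.
  have -> : \sum_(j < M) p (xi j) y `^ ex b = M%:R * avg (fun j => p (xi j) y `^ ex b).
    by rewrite /avg card_ord mulVKf // gt_eqF.
  move: da1 da2 dm m1 m2; rewrite ler_norml.
  set Ax := avg _; set Ay := avg _; set mx := mean _; set my := mean _.
  have -> : (24 * n)^-1 = (4 * n)^-1 / 6 by field; rewrite gt_eqF.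
  have ht : initial_tau <= M%:R * ((4 * n)^-1 / 12).
    rewrite [leRHS](_ : _ = M%:R / (48 * n)); last by field; rewrite gt_eqF.
    by rewrite ler_pdivlMr ?mulr_gt0 // mulrC.
  set v := (4 * n)^-1 in ht *.
  move=> da1 da2 dm m1 m2 /andP[S1 S2].
  have mt : initial_tau <= M%:R * (my / 12).
    by apply: le_trans ht _; rewrite ler_pM2l // ler_pM2r.
  (* The deviation [2 * initial_tau] costs at most [my / 6] per point, leaving the factors 1/2 and
     3; the net errors [v / 6], with [v <= mx], widen these to 1/4 and 4. *)
  have S1' : M%:R * (my / 2) <= M%:R * Ay by lra.
  have S2' : M%:R * Ay <= M%:R * (3 * my).
    have : 0 <= M%:R * my by rewrite mulr_ge0 ?(ltW MR) //; apply: le_trans m2; rewrite invr_ge0 mulr_ge0 // ltW.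
    lra.
  move: S1' S2'; rewrite !ler_pM2l // => S1' S2'.
  by apply/andP; split; lra.
have [s0|sn] := eqVneq (\sum_i `|x i|) 0.
  have px w : p w x `^ ex b = 0.
    have -> : p w x = 0.
      by apply/eqP; rewrite eq_le (snorm_ge0 hp) andbT; apply: le_trans (snorm_le_sum hp w x) _; rewrite s0 mulr0.
    by rewrite powR0 // gt_eqF //; have := hex b; lra.
  under eq_fun do rewrite px; under [X in _ <= avg X <= _]eq_fun do rewrite px.
  by rewrite (mean_cst hm) avg_cst // mul0r mulr0 lexx.
have spos : 0 < \sum_i `|x i| by rewrite lt0r sn sumr_ge0.
set S := \sum_i _ in spos; pose c := (2 * S)^-1.
have c0 : 0 < c by rewrite invr_gt0 mulr_gt0.
have hcx : half [ffun i => c * x i].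
  rewrite /half (eq_bigr (fun i => c * `|x i|)); last by move=> i _; rewrite ffunE normrM gtr0_norm.
  by rewrite -mulr_sumr -/S /c; field; rewrite gt_eqF.
have pc w : p w [ffun i => c * x i] `^ ex b = c `^ ex b * p w x `^ ex b.
  by rewrite (snormZ hp) gtr0_norm // powRM ?(ltW c0) ?(snorm_ge0 hp).
have := unit _ hcx.
under eq_fun do rewrite pc; under [X in _ <= avg X <= _]eq_fun do rewrite pc.
rewrite (meanZ hm) ?avgZ; last exact: p_adm.
have cr : 0 < c `^ ex b by exact: powR_gt0.
by rewrite -mulrA [4 * _]mulrCA !ler_pM2l.
Qed.

End InitialDiscretization.

(** * The mean over the torus *)

Section CircleMean.
Variable R : realType.
Local Open Scope classical_set_scope.
Implicit Types g h : R -> R.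

Definition lip1 g : Prop := exists L : R, forall s t, `|g s - g t| <= L * `|s - t|.

Definition circle_mean g : R :=
  (2 * pi)^-1 * Rintegral lebesgue_measure `[0, 2 * pi] g.

Let twopi0 : 0 < 2 * pi :> R. Proof. by rewrite mulr_gt0 // pi_gt0. Qed.

Lemma lip1_continuous g : lip1 g -> continuous g.
Proof.
move=> [L hL] t; apply/cvgrPdist_le => e e0.
have K0 : 0 < `|L| + 1 by rewrite ltr_wpDl.
near=> s.
apply: le_trans (hL t s) _; apply: (@le_trans _ _ ((`|L| + 1) * `|t - s|)).
  by rewrite ler_wpM2r //; apply: le_trans (ler_norm L) _; rewrite lerDl.
rewrite mulrC -ler_pdivlMr //.
by near: s; apply: cvgr_dist_le; [exact: cvg_id | rewrite divr_gt0].
Unshelve. all: by end_near. Qed.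

Lemma circle_integrable g : continuous g ->
  (@lebesgue_measure R).-integrable `[0, 2 * pi] (EFin \o g).
Proof.
move=> cg; apply: continuous_compact_integrable; first exact: segment_compact.
by apply: continuous_subspaceT.
Qed.

Lemma circle_mean_cst (c : R) : circle_mean (fun=> c) = c.
Proof.
have mu : lebesgue_measure `[(0 : R), 2 * pi] = (2 * pi)%:E.
  by rewrite lebesgue_measure_itv /= lte_fin twopi0 -EFinB subr0.
rewrite /circle_mean Rintegral_cst //; transitivity ((2 * pi)^-1 * (c * fine (2 * pi)%:E)).
  by congr (_ * (_ * fine _)); exact: mu.
by rewrite mulrCA mulVf ?mulr1 // gt_eqF.
Qed.

Lemma circle_meanD g h : continuous g -> continuous h ->
  circle_mean (fun t => g t + h t) = circle_mean g + circle_mean h.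
Proof.
by move=> cg ch; rewrite /circle_mean -mulrDr RintegralD //; exact: circle_integrable.
Qed.

Lemma circle_meanZ (c : R) g : continuous g ->
  circle_mean (fun t => c * g t) = c * circle_mean g.
Proof.
by move=> cg; rewrite /circle_mean RintegralZl // 1?mulrCA //; exact: circle_integrable.
Qed.

Lemma circle_mean_le g h : continuous g -> continuous h ->
  (forall t, 0 <= t <= 2 * pi -> g t <= h t) -> circle_mean g <= circle_mean h.
Proof.
move=> cg ch gh; rewrite /circle_mean ler_pM2l ?invr_gt0 //.
apply: le_Rintegral => //; try exact: circle_integrable.
Qed.

Lemma sin_cos_lip (x y : R) : `|sin x - sin y| <= `|x - y| /\ `|cos x - cos y| <= `|x - y|.
Proof.
have main (u v : R) : u <= v -> `|sin v - sin u| <= `|v - u| /\ `|cos v - cos u| <= `|v - u|.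
  move=> uv; split.
    have cs : {within `[u, v], continuous (@sin R)}.
      by apply: continuous_subspaceT => t; exact: continuous_sin.
    have [c _ ->] := MVT_segment uv (fun t _ => is_derive_sin t) cs.
    by rewrite normrM ler_piMl // cos_max.
  have cc : {within `[u, v], continuous (@cos R)}.
    by apply: continuous_subspaceT => t; exact: continuous_cos.
  have [c _ ->] := MVT_segment uv (fun t _ => is_derive_cos t) cc.
  by rewrite normrM normrN ler_piMl // sin_max.
have [/main|/ltW/main//] := leP x y.
by rewrite (distrC (sin _)) (distrC (cos _)) (distrC x).
Qed.

Lemma sinD_2pi_int (a : R) (z : int) : sin (a + z%:~R * (2 * pi)) = sin a.
Proof.
have nat_case n (b : R) : sin (b + n%:R * (2 * pi)) = sin b.
  by rewrite mulr_natl (_ : 2 * pi = pi *+ 2) ?mulr_natl // periodicn //; exact: sinD2pi.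
case: z => n; first exact: nat_case.
by rewrite NegzE -(nat_case n.+1) mulNr -addrA addNr addr0.
Qed.

Lemma circle_mean_cos (a : R) (z : int) :
  circle_mean (fun t => cos (a + z%:~R * t)) = if z == 0 then cos a else 0.
Proof.
case: eqVneq => [->|z0].
  by under eq_fun do rewrite mul0r addr0; rewrite circle_mean_cst.
have zR : z%:~R != 0 :> R by rewrite intr_eq0.
pose F t : R := sin (a + z%:~R * t) / z%:~R.
have dF (t : R) : is_derive t 1 F (cos (a + z%:~R * t)).
  have d1 : is_derive t 1 (fun t => a + z%:~R * t) (z%:~R : R).
    have -> : (fun t => a + z%:~R * t) = cst a + (z%:~R : R) \*: (@id R) by [].
    by apply: is_derive_eq; rewrite add0r /GRing.scale /= mulr1.
  have d2 : is_derive t 1 (fun t => sin (a + z%:~R * t)) (z%:~R * cos (a + z%:~R * t)).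
    have := @is_derive1_comp _ (@sin R) (fun t => a + z%:~R * t) t _ _ (is_derive_sin _) d1.
    by rewrite mulrC.
  have -> : F = (z%:~R^-1 : R) \*: (fun t => sin (a + z%:~R * t)).
    by apply/funext => s; rewrite /F mulrC.
  by apply: is_derive_eq; rewrite /GRing.scale /= mulrA mulVf // mul1r.
have cF : continuous F.
  by move=> t; apply: differentiable_continuous; apply/derivable1_diffP; case: (dF t).
rewrite /circle_mean /Rintegral (@continuous_FTC2 _ _ F) //.
- by rewrite /F /= mulr0 addr0 sinD_2pi_int subrr mulr0.
- apply: continuous_subspaceT; apply: lip1_continuous; exists `|z%:~R| => s t.
  apply: le_trans (proj2 (sin_cos_lip _ _)) _.
  by rewrite opprD addrACA subrr add0r -mulrBr normrM.
- split; first by move=> t _; case: (dF t).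
    by apply: cvg_at_right_filter; exact: cF.
  by apply: cvg_at_left_filter; exact: cF.
- by move=> t _; rewrite derive1E; case: (dF t).
Qed.

End CircleMean.

(** * Iterated means, sample points and orthogonality on the torus *)

Section TorusMean.
Variables (R : realType) (d : nat).
Implicit Types (x y : 'rV[R]_d) (F G : 'rV[R]_d -> R).

Definition dist1 x y : R := \sum_j `|x ord0 j - y ord0 j|.

Definition lip F : Prop := exists2 L : R, 0 <= L & forall x y, `|F x - F y| <= L * dist1 x y.

Definition closed_cube x : Prop := forall j, 0 <= x ord0 j <= 2 * pi.

Lemma lip_cst (c : R) : lip (fun=> c).
Proof. by exists 0 => // x y; rewrite subrr normr0 mul0r. Qed.

Lemma lipD F G : lip F -> lip G -> lip (fun x => F x + G x).
Proof.
move=> [L L0 hL] [K K0 hK]; exists (L + K) => [|x y]; first exact: addr_ge0.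
rewrite opprD addrACA mulrDl; apply: le_trans (ler_normD _ _) _; exact: lerD.
Qed.

Lemma lipZ (c : R) F : lip F -> lip (fun x => c * F x).
Proof.
move=> [L L0 hL]; exists (`|c| * L) => [|x y]; first exact: mulr_ge0.
by rewrite -mulrBr normrM -mulrA ler_wpM2l.
Qed.

Lemma dist1_upd n (t : R) x y : dist1 (upd n t x) (upd n t y) <= dist1 x y.
Proof.
by apply: ler_sum => j _; rewrite !mxE; case: ifP => // _; rewrite subrr normr0.
Qed.

Lemma dist1_upd_param n (s t : R) x : dist1 (upd n s x) (upd n t x) <= `|s - t|.
Proof.
rewrite /dist1 (eq_bigr (fun j : 'I_d => if (j : nat) == n then `|s - t| else 0)); last first.
  by move=> j _; rewrite !mxE; case: ifP => // _; rewrite subrr normr0.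
have [dn|nd] := leqP d n.
  by rewrite big1 // => j _; rewrite ltn_eqF // (leq_trans (ltn_ord j)).
rewrite (bigD1 (Ordinal nd)) //= eqxx big1 ?addr0 // => j.
by rewrite -val_eqE /= => /negPf ->.
Qed.

Lemma lip_upd n (t : R) F : lip F -> lip (fun x => F (upd n t x)).
Proof.
move=> [L L0 hL]; exists L => // x y; apply: le_trans (hL _ _) _.
by rewrite ler_wpM2l // dist1_upd.
Qed.

Lemma closed_cube_upd n (t : R) x : 0 <= t <= 2 * pi -> closed_cube x -> closed_cube (upd n t x).
Proof. by move=> ht hx j; rewrite mxE; case: ifP. Qed.

Record monotone_mean (mean : ('rV[R]_d -> R) -> R) : Prop := MonotoneMean {
  mmean_cst : forall c, mean (fun=> c) = c;
  mmeanD : forall F G, lip F -> lip G -> mean (fun x => F x + G x) = mean F + mean G;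
  mmeanZ : forall c F, lip F -> mean (fun x => c * F x) = c * mean F;
  mmean_le : forall F G, lip F -> lip G -> (forall x, closed_cube x -> F x <= G x) ->
    mean F <= mean G }.

Lemma mmean_upd_lip1 mean n F : monotone_mean mean -> lip F ->
  lip1 (fun t => mean (fun x => F (upd n t x))).
Proof.
move=> hm lF; have [L L0 hL] := lF; exists L => s t.
have main u v : mean (fun x => F (upd n u x)) - mean (fun x => F (upd n v x)) <= L * `|u - v|.
  rewrite lerBlDl -[L * _](mmean_cst hm) -(mmeanD hm (lip_upd n v lF) (lip_cst _)).
  apply: (mmean_le hm) => [||x _]; [exact: lip_upd|by apply: lipD; [exact: lip_upd|exact: lip_cst]|].
  rewrite -lerBlDl; apply: le_trans (ler_norm _) _; apply: le_trans (hL _ _) _.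
  by rewrite ler_wpM2l // dist1_upd_param.
by rewrite ler_norml lerNl opprB main distrC main.
Qed.

Lemma tint_auxS n F :
  tint_aux n.+1 F = circle_mean (fun t => tint_aux n (fun x => F (upd n t x))).
Proof. by []. Qed.

Lemma tint_monotone_mean n : monotone_mean (@tint_aux R d n).
Proof.
elim: n => [|n IH].
  have c0 : closed_cube 0 by move=> j; rewrite mxE lexx /= mulr_ge0 // pi_ge0.
  by split=> // F G _ _ /(_ 0 c0).
have cont F : lip F -> continuous (fun t => tint_aux n (fun x => F (upd n t x))).
  by move=> lF; apply: lip1_continuous; exact: mmean_upd_lip1.
split=> [c|F G lF lG|c F lF|F G lF lG FG]; rewrite !tint_auxS.
- by under eq_fun do rewrite (mmean_cst IH); rewrite circle_mean_cst.
- under eq_fun do rewrite (mmeanD IH (lip_upd _ _ lF) (lip_upd _ _ lG)).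
  by rewrite circle_meanD //; exact: cont.
- under eq_fun do rewrite (mmeanZ IH _ (lip_upd _ _ lF)).
  by rewrite circle_meanZ //; exact: cont.
- apply: circle_mean_le; [exact: cont|exact: cont|] => t ht.
  apply: (mmean_le IH); [exact: lip_upd|exact: lip_upd|] => x hx.
  by apply: FG; exact: closed_cube_upd.
Qed.

(** Integration runs over the closed cube while sample points must lie in the half-open one. If [F]
    exceeded its mean by [e] on the latter, contracting the closed cube by [1 - r] into it would
    change [F] by at most [e / 2], and monotonicity on the closed cube would give a
    contradiction. *)
Lemma torus_mean_functional :
  mean_functional (@in_torus R d) lip (@torus_mean R d).
Proof.
have hm := tint_monotone_mean d.
split; [exact: lip_cst|exact: lipD|exact: lipZ|exact: mmean_cst|exact: mmeanD|exact: mmeanZ| |].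
  by move=> F G lF lG FG; apply: (mmean_le hm) => // x _; exact: FG.
move=> F e lF e0; have [L L0 hL] := lF.
apply: contrapT => no.
have big x : in_torus x -> torus_mean F + e <= F x.
  by move=> hx; rewrite leNgt; apply/negP => h; apply: no; exists x.
have p0 := pi_gt0 R.
pose B := L * (d%:R * (2 * pi)) : R.
have B0 : 0 <= B by rewrite !mulr_ge0 // ltW.
pose r := e / (2 * (B + e)).
have r0 : 0 < r by rewrite divr_gt0 // mulr_gt0 // ltr_wpDl.
have r1 : r <= 1 by rewrite ler_pdivrMr ?mul1r; lra.
have rB : r * B <= e / 2.
  rewrite /r mulrAC ler_pdivrMr; last by lra.
  by nra.
suff : torus_mean F + e / 2 <= torus_mean F by lra.
rewrite -[leLHS](mmean_cst hm); apply: (mmean_le hm) => //; first exact: lip_cst.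
move=> x hx; have sx : in_torus ((1 - r) *: x).
  move=> j; rewrite mxE; have /andP[x0 x1] := hx j; apply/andP; split; first by rewrite mulr_ge0 // subr_ge0.
  by nra.
have := hL x ((1 - r) *: x); have := big _ sx; rewrite ler_norml.
have : L * dist1 x ((1 - r) *: x) <= r * B.
  rewrite /B mulrCA ler_wpM2l //.
  have -> : r * (d%:R * (2 * pi)) = \sum_(j < d) r * (2 * pi).
    by rewrite sumr_const card_ord -[RHS]mulr_natl mulrCA.
  apply: ler_sum => j _; rewrite mxE; have /andP[x0 x1] := hx j.
  rewrite (_ : _ - _ = r * x ord0 j); last by ring.
  rewrite ger0_norm; first by apply: ler_wpM2l => //; exact: ltW.
  by rewrite mulr_ge0 // ltW.
lra.
Qed.

Lemma dotZR0 (k : 'rV[int]_d) : dotZR k (0 : 'rV[R]_d) = 0.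
Proof. by rewrite /dotZR big1 // => j _; rewrite mxE mulr0. Qed.

Lemma dotZR_upd (k : 'rV[int]_d) (n : nat) (hn : (n < d)%N) (t : R) x :
  dotZR k (upd n t x) =
  (k ord0 (Ordinal hn))%:~R * t + dotZR (\row_j if (j : nat) == n then 0 else k ord0 j) x.
Proof.
rewrite /dotZR (bigD1 (Ordinal hn)) //= mxE eqxx; congr (_ + _).
rewrite [RHS](bigD1 (Ordinal hn)) //= mxE eqxx mul0r add0r.
by apply: eq_bigr => j; rewrite -val_eqE /= !mxE => /negPf ->.
Qed.

(** The coordinates from [n] on are 0 in [tint_aux n]. The phase [a] is general so that the
    induction can absorb the term of the outermost variable into it. *)
Lemma tint_cos n (k : 'rV[int]_d) (a : R) : (n <= d)%N ->
  tint_aux n (fun x => cos (a + dotZR k x)) =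
  if [forall j : 'I_d, (j < n)%N ==> (k ord0 j == 0)] then cos a else 0.
Proof.
elim: n k a => [|n IH] k a hn.
  by rewrite /= dotZR0 addr0; case: forallP => // -[] j.
rewrite tint_auxS; under eq_fun do under eq_fun do rewrite (dotZR_upd k hn) addrA.
under eq_fun do rewrite IH ?(ltnW hn) //.
have -> : [forall j : 'I_d, (j < n)%N ==> ((\row_j (if (j : nat) == n then 0 else k ord0 j)) ord0 j == 0)]
   = [forall j : 'I_d, (j < n)%N ==> (k ord0 j == 0)].
  apply: eq_forallb => j; rewrite mxE; case: (ltngtP j n) => //= jn.
have -> : [forall j : 'I_d, (j < n.+1)%N ==> (k ord0 j == 0)] =
   (k ord0 (Ordinal hn) == 0) && [forall j : 'I_d, (j < n)%N ==> (k ord0 j == 0)].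
  apply/forallP/andP => [h|[h1 /forallP h2] j].
    split; first by have := h (Ordinal hn); rewrite /= ltnSn.
    by apply/forallP => j; apply/implyP => jn; have := h j; rewrite ltnS (ltnW jn).
  apply/implyP; rewrite ltnS leq_eqVlt => /orP[/eqP jn|jn]; last by have := h2 j; rewrite jn.
  by rewrite (_ : j = Ordinal hn) //; exact: val_inj.
case: [forall j, _]; last by rewrite andbF circle_mean_cst.
by rewrite andbT circle_mean_cos.
Qed.

Lemma torus_mean_cos (k : 'rV[int]_d) (a : R) :
  torus_mean (fun x => cos (a + dotZR k x)) = if k == 0 then cos a else 0.
Proof.
rewrite /torus_mean tint_cos //; congr (if _ then _ else _).
apply/forallP/eqP => [h|-> j]; last by rewrite mxE eqxx implybT.
by apply/rowP => j; have := h j; rewrite ltn_ord mxE => /eqP.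
Qed.

End TorusMean.

(** * Trigonometric polynomials as bounded seminorms *)

Section TrigSeminorms.
Variables (R : realType) (d : nat) (Q : {fset 'rV[int]_d}).
Let I : finType := (Q * bool)%type.
Implicit Types (x y : {ffun I -> R}) (w : 'rV[R]_d).

Lemma dotZRB (k k' : 'rV[int]_d) w : dotZR (k - k') w = dotZR k w - dotZR k' w.
Proof.
by rewrite /dotZR -sumrB; apply: eq_bigr => j _; rewrite !mxE rmorphB /= mulrBl.
Qed.

(* The functional [(w, true)] is the real part at [w], [(w, false)] the imaginary
   part; the coordinates [(k, true)], [(k, false)] are the parts of [c k]. *)
Definition trig_functional (g : 'rV[R]_d * bool) (i : I) : R :=
  let t := dotZR (val i.1) g.1 in
  if g.2 then (if i.2 then cos t else - sin t) else (if i.2 then sin t else cos t).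

Definition trig_part w (b : bool) x : R := \sum_i trig_functional (w, b) i * x i.

Definition trig_snorm w x : R := cabs (trig_part w true x +i* trig_part w false x)%C.

Definition coef_vector (c : 'rV[int]_d -> R[i]) : {ffun I -> R} :=
  [ffun i => if i.2 then complex.Re (c (val i.1)) else complex.Im (c (val i.1))].

Lemma trig_partE w b x : trig_part w b x =
  \sum_(k : Q) (trig_functional (w, b) (k, true) * x (k, true)
              + trig_functional (w, b) (k, false) * x (k, false)).
Proof.
rewrite /trig_part.
rewrite (eq_bigr (fun i : Q * bool => trig_functional (w, b) (i.1, i.2) * x (i.1, i.2))); last by case.
rewrite -(pair_bigA _ (fun k c => trig_functional (w, b) (k, c) * x (k, c))) /=.
by apply: eq_bigr => k _; rewrite big_bool.
Qed.

Lemma cabs_trig_poly (c : 'rV[int]_d -> R[i]) w :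
  cabs (trig_poly Q c w) = trig_snorm w (coef_vector c).
Proof.
rewrite /trig_snorm /trig_poly big_seq_fsetE; congr cabs; rewrite !trig_partE.
apply: (big_ind3 (fun (z : R[i]) (a b : R) => z = (a +i* b)%C)) => //.
  by move=> _ a b _ a' b' -> ->.
move=> k _; rewrite !ffunE /=; case: (c (val k)) => a b; rewrite /expi /trig_functional /=.
by apply/eqP; rewrite eq_complex /=; apply/andP; split; apply/eqP; ring.
Qed.

Lemma cabs_le (a b : R) : cabs (a +i* b)%C <= `|a| + `|b|.
Proof.
rewrite /cabs /= -[leRHS]ger0_norm ?addr_ge0 // -sqrtr_sqr ler_sqrt ?sqr_ge0 //.
rewrite sqrrD !real_normK ?num_real // lerD2r lerDl.
by rewrite mulrn_wge0 // mulr_ge0.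
Qed.

Lemma cabsD (a b a' b' : R) :
  cabs ((a + a') +i* (b + b'))%C <= cabs (a +i* b)%C + cabs (a' +i* b')%C.
Proof. exact: (@le_normcD _ (a +i* b)%C (a' +i* b')%C). Qed.

Lemma trig_part_lin w b (c : R) x y :
  trig_part w b (x + y) = trig_part w b x + trig_part w b y /\
  trig_part w b [ffun i => c * x i] = c * trig_part w b x.
Proof.
split; first by rewrite -big_split; apply: eq_bigr => i _; rewrite ffunE mulrDr.
by rewrite mulr_sumr; apply: eq_bigr => i _; rewrite ffunE mulrCA.
Qed.

Lemma trig_bounded_seminorms : bounded_seminorms trig_functional trig_snorm.
Proof.
split.
- move=> [w b] [k e]; rewrite /trig_functional /=.
  by case: b; case: e; rewrite ?normrN ?cos_max ?sin_max.
- by move=> w x; rewrite /trig_snorm /cabs /= sqrtr_ge0.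
- move=> w x y; rewrite /trig_snorm !(proj1 (trig_part_lin _ _ 0 _ _)).
  exact: cabsD.
- move=> w c x; rewrite /trig_snorm !(proj2 (trig_part_lin _ _ c x x)) /cabs /=.
  by rewrite !exprMn -mulrDr sqrtrM ?sqr_ge0 // sqrtr_sqr.
- by move=> w x; exact: cabs_le.
Qed.

Lemma lip_sum (J : Type) (s : seq J) (F : J -> 'rV[R]_d -> R) :
  (forall j, lip (F j)) -> lip (fun w => \sum_(j <- s) F j w).
Proof.
move=> hF; elim: s => [|j s IH].
  by under eq_fun do rewrite big_nil; exact: lip_cst.
by under eq_fun do rewrite big_cons; exact: lipD.
Qed.

Lemma lip_dotZR (k : 'rV[int]_d) : exists2 L : R, 0 <= L &
  forall w w', `|dotZR k w - dotZR k w'| <= L * dist1 w w'.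
Proof.
exists (\sum_j `|(k ord0 j)%:~R|) => [|w w']; first exact: sumr_ge0.
rewrite /dotZR -sumrB; apply: le_trans (ler_norm_sum _ _ _) _.
rewrite /dist1 mulr_sumr; apply: ler_sum => j _; rewrite -mulrBr normrM ler_wpM2r //.
by rewrite (bigD1 j) //= lerDl sumr_ge0.
Qed.

Lemma lip_cos (k : 'rV[int]_d) (a : R) : lip (fun w => cos (a + dotZR k w)).
Proof.
have [L L0 hL] := lip_dotZR k; exists L => // w w'.
apply: le_trans (proj2 (sin_cos_lip _ _)) _.
by rewrite opprD addrACA subrr add0r.
Qed.

Lemma lip_sin (k : 'rV[int]_d) : lip (fun w => sin (dotZR k w)).
Proof.
have [L L0 hL] := lip_dotZR k; exists L => // w w'.
exact: le_trans (proj1 (sin_cos_lip _ _)) _.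
Qed.

Lemma lip_trig_part b x : lip (fun w => trig_part w b x).
Proof.
apply: lip_sum => -[k e]; under eq_fun do rewrite mulrC.
apply: lipZ; rewrite /trig_functional /=.
have c : lip (fun w => cos (dotZR (val k) w)).
  by have := lip_cos (val k) 0; under eq_fun do rewrite add0r.
have s := lip_sin (val k).
by case: b; case: e => //; under eq_fun do rewrite -mulN1r; exact: lipZ.
Qed.

Lemma lip_trig_snorm x : lip (fun w => trig_snorm w x).
Proof.
have [L L0 hL] := lip_trig_part true x; have [K K0 hK] := lip_trig_part false x.
exists (L + K) => [|w w']; first exact: addr_ge0.
have main u v : trig_snorm u x - trig_snorm v x <= (L + K) * dist1 u v.
  rewrite lerBlDl; apply: (@le_trans _ _ (trig_snorm v x + cabs
     ((trig_part u true x - trig_part v true x) +i* (trig_part u false x - trig_part v false x))%C)).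
    apply: le_trans (cabsD _ _ _ _).
    by rewrite ![trig_part v _ x + _]addrC !subrK.
  rewrite lerD2l; apply: le_trans (cabs_le _ _) _.
  by rewrite mulrDl lerD.
rewrite ler_norml lerNl opprB main andbT.
by apply: le_trans (main _ _) _; rewrite ler_wpM2l ?addr_ge0 // /dist1; apply: ler_sum => j _; rewrite distrC.
Qed.

(** Dividing by the uniform bound [B] brings the values into [0, 1], where [powR_sub_le] applies;
    the summand 1 keeps [B] positive for [x = 0]. *)
Lemma lip_trig_snorm_powR (r : R) x : 1 <= r <= 2 -> lip (fun w => trig_snorm w x `^ r).
Proof.
move=> hr; have [L L0 hL] := lip_trig_snorm x.
pose B : R := 2 * (\sum_i `|x i|) + 1.
have B0 : 0 < B by rewrite ltr_wpDl // mulr_ge0 ?sumr_ge0.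
have hB w : 0 <= trig_snorm w x / B <= 1.
  rewrite divr_ge0 ?(snorm_ge0 trig_bounded_seminorms) ?(ltW B0) //= ler_pdivrMr // mul1r.
  by apply: le_trans (snorm_le_sum trig_bounded_seminorms w x) _; rewrite lerDl.
have C0 : 0 <= B `^ r * (2 * B^-1) by rewrite mulr_ge0 ?powR_ge0 // mulr_ge0 // invr_ge0 ltW.
exists (B `^ r * (2 * B^-1) * L) => [|w w']; first exact: mulr_ge0.
have e v : trig_snorm v x `^ r = B `^ r * (trig_snorm v x / B) `^ r.
  rewrite -powRM ?(ltW B0) //; last by case/andP: (hB v).
  by rewrite mulrCA divff ?mulr1 // gt_eqF.
rewrite !e -mulrBr normrM ger0_norm ?powR_ge0 // -!mulrA ler_wpM2l ?powR_ge0 //.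
apply: le_trans (powR_sub_le hr (hB w) (hB w')) _; rewrite ler_pM2l //.
by rewrite -mulrBl normrM mulrC (@gtr0_norm _ B^-1) ?invr_gt0 // ler_pM2l ?invr_gt0.
Qed.

(** Sines are written as cosines of phase [- pi / 2], so that [torus_mean_cos] evaluates both sums;
    the second has mean zero even on the diagonal. *)
Lemma trig_snorm_sqr w x : trig_snorm w x ^+ 2 =
  \sum_(u : Q * Q) (x (u.1, true) * x (u.2, true) + x (u.1, false) * x (u.2, false))
     * cos (0 + dotZR (val u.1 - val u.2) w) +
  \sum_(u : Q * Q) (x (u.1, true) * x (u.2, false) - x (u.1, false) * x (u.2, true))
     * cos (- (pi / 2) + dotZR (val u.1 - val u.2) w).
Proof.
rewrite /trig_snorm /cabs /= sqr_sqrtr ?addr_ge0 ?sqr_ge0 // !expr2 !trig_partE !big_distrlr /=.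
rewrite !pair_bigA /= -!big_split /=; apply: eq_bigr => -[k k'] _ /=.
rewrite add0r [- _ + _]addrC cosBpihalf dotZRB cosB sinB /trig_functional /=.
by ring.
Qed.

Lemma parseval x : torus_mean (fun w => trig_snorm w x ^+ 2) = \sum_i x i ^+ 2.
Proof.
have hm := torus_mean_functional R d.
have l1 (a : R) (u : Q * Q) : lip (fun w => cos (a + dotZR (val u.1 - val u.2) w)) by exact: lip_cos.
under eq_fun do rewrite trig_snorm_sqr.
rewrite (meanD hm (adm_lincomb hm _ _ (l1 0)) (adm_lincomb hm _ _ (l1 _))).
rewrite (mean_lincomb hm _ _ (l1 0)) (mean_lincomb hm _ _ (l1 _)).
rewrite [X in _ + X]big1 ?addr0; last first.
  by move=> u _; rewrite torus_mean_cos cosN cos_pihalf if_same mulr0.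
rewrite -(pair_bigA _ (fun k k' : Q => (x (k, true) * x (k', true) + x (k, false) * x (k', false)) *
  torus_mean (fun w => cos (0 + dotZR (val k - val k') w)))) /=.
rewrite (eq_bigr (fun i : Q * bool => x (i.1, i.2) ^+ 2)); last by case.
rewrite -(pair_bigA _ (fun k c => x (k, c) ^+ 2)) /=; apply: eq_bigr => k _.
rewrite (bigD1 k) //= torus_mean_cos subrr eqxx cos0 mulr1 big1 ?addr0 ?big_bool // => k' kk'.
by rewrite torus_mean_cos subr_eq0 val_eqE eq_sym (negPf kk') mulr0.
Qed.

End TrigSeminorms.

(** * Choice of numerical parameters *)

Section NumericalChoices.
Variable R : realType.

Lemma half_le_ln2 : 2^-1 <= ln 2 :> R.
Proof.
rewrite -[leLHS]expRK ler_ln ?posrE ?expR_gt0 //.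
have := @expR_half_le R 1; rewrite lexx ler01 => /(_ isT).
by rewrite mul1r.
Qed.

Variables (r : R).
Hypothesis r2 : 2 <= r.

Let r0 : 0 < r. Proof. by apply: lt_le_trans r2. Qed.
Let r1 : 1 <= r. Proof. by apply: le_trans r2; lra. Qed.

Lemma natr_le_expr (a k : nat) : (a <= 2 ^ k)%N -> a%:R <= r ^+ k.
Proof.
move=> h; apply: (@le_trans _ _ (2 ^+ k)); first by rewrite -natrX ler_nat.
by apply: lerXn2r; rewrite ?nnegrE // ltW.
Qed.

(** Constants are absorbed into powers of [r >= 2], so that the initial number of points is a pure
    power of [r] and its logarithm a multiple of [ln r]. *)
Lemma initial_size_le : 48 * r * (96 * r ^+ 2 * (96 * r) ^+ 2 + 8) <= r ^+ 33.
Proof.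
have a48 : 48 <= r ^+ 6 by exact: (@natr_le_expr 48 6).
have a96 : 96 <= r ^+ 7 by exact: (@natr_le_expr 96 7).
have a8 : 8 <= r ^+ 3 by exact: (@natr_le_expr 8 3).
have h1 : 96 * r ^+ 2 * (96 * r) ^+ 2 <= r ^+ 25.
  rewrite (_ : r ^+ 25 = r ^+ 7 * r ^+ 2 * (r ^+ 7 * r) ^+ 2); last by ring.
  apply: ler_pM; rewrite ?mulr_ge0 ?sqr_ge0 ?exprn_ge0 ?ler0n ?(ltW r0) //.
    by rewrite ler_wpM2r ?exprn_ge0 // ltW.
  by apply: lerXn2r; rewrite ?nnegrE ?mulr_ge0 ?exprn_ge0 ?ler0n ?(ltW r0) // ler_wpM2r // ltW.
have h2 : 96 * r ^+ 2 * (96 * r) ^+ 2 + 8 <= r ^+ 26.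
  apply: (@le_trans _ _ (2 * r ^+ 25)); last by rewrite [leRHS]exprS ler_wpM2r ?exprn_ge0 // ltW.
  have : 8 <= r ^+ 25.
    by apply: le_trans a8 _; apply: ler_weXn2l.
  lra.
rewrite (_ : r ^+ 33 = r ^+ 6 * r * r ^+ 26); last by ring.
apply: ler_pM; rewrite ?mulr_ge0 ?addr_ge0 ?mulr_ge0 ?sqr_ge0 ?ler0n ?(ltW r0) //.
by rewrite ler_wpM2r // ltW.
Qed.

Lemma ln_sample_size_le : ln (8 * r ^+ 33) <= 36 * ln r.
Proof.
have -> : 36 * ln r = ln (r ^+ 36) by rewrite lnXn // mulr_natl.
rewrite ler_ln ?posrE ?mulr_gt0 ?exprn_gt0 //.
rewrite (_ : r ^+ 36 = r ^+ 3 * r ^+ 33); last by rewrite -exprD.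
by rewrite ler_wpM2r ?exprn_ge0 ?(ltW r0) //; exact: (@natr_le_expr 8 3).
Qed.

(** The least [kk] satisfies [2 ^ kk <= 2 c <= r ^ (k + 1)]; since [ln 2 >= 1/2], this bounds [kk]
    by [2 (k + 1) ln r], and the successor costs one more [2 ln r]. *)
Lemma exists_level_count (c : R) (k : nat) : 1 <= c -> c <= r ^+ k ->
  exists2 kk : nat, c <= 2 ^+ kk & kk.+1%:R <= (2 * k.+2%:R) * ln r.
Proof.
move=> c1 ck.
have l2 := half_le_ln2; have lr : ln 2 <= ln r by rewrite ler_ln ?posrE.
have ex : exists kk, c <= 2 ^+ kk.
  exists (Num.truncn c).+1; apply: le_trans (ltW (truncnS_gt c)) _.
  by rewrite -natrX ler_nat ltnW // ltn_expl.
case: (ex_minnP ex) => kk hkk hmin; exists kk => //.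
have h : (2 : R) ^+ kk <= 2 * c.
  case: kk hkk hmin => [|kk] _ hmin; first by rewrite expr0; lra.
  rewrite exprS ler_pM2l // ltW // ltNge; apply/negP => /hmin.
  by rewrite ltnn.
have : kk%:R * ln 2 <= k.+1%:R * ln r.
  rewrite mulr_natl mulr_natl -!lnXn // ler_ln ?posrE ?exprn_gt0 //.
  by apply: le_trans h _; rewrite exprS ler_pM //; lra.
have : kk%:R * 2^-1 <= kk%:R * ln 2 :> R by rewrite ler_wpM2l.
rewrite -[kk.+1%:R]natr1 -[k.+2%:R]natr1; lra.
Qed.

End NumericalChoices.

(** * Composition of the two discretizations *)

Section Assembly.
Variables (R : realType) (q : R) (d : nat) (Q : {fset 'rV[int]_d}).
Hypotheses (hq : 1 <= q <= 2) (Q0 : (0 < #|` Q|)%N).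

Let I : finType := (Q * bool)%type.
Let r : R := 2 * #|` Q|%:R.

Let card_I : #|I| = (2 * #|` Q|)%N.
Proof. by rewrite card_prod card_bool mulnC cardfE. Qed.

Let rE : #|I|%:R = r. Proof. by rewrite card_I natrM. Qed.
Let r2 : 2 <= r. Proof. by rewrite ler_peMr // ler1n. Qed.
Let I0 : (0 < #|I|)%N. Proof. by rewrite card_I muln_gt0. Qed.

(** The first selection loses a factor 4 on each side, which turns 800 and 300 into 3200 and 1200;
    its case of exponent 2 with Parseval supplies [K = 4]. The 36 bounds [log_card], and 24 is
    [2 * (10 + 2)] from [exists_level_count]. *)
Lemma discretization (m : nat) :
  1000 * (1026 * (36 * ln r) * (4 * 4 * r) * (24 * ln r)) <= m%:R ->
  MZ_class Q m q (3200^-1) 1200.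
Proof.
move: rE r2; move: (r) => s sE s2 hm.
have lr : 0 < ln s by apply: ln_gt0; lra.
have s0 : 0 < s by lra.
have m0 : (0 < m)%N.
  rewrite -(ltr0n R); apply: lt_le_trans hm.
  by repeat apply: mulr_gt0; rewrite ?ltr0n.
pose M := (#|I| ^ 33)%N.
have ME : M%:R = s ^+ 33 by rewrite natrX sE.
have M0 : (0 < M)%N by rewrite expn_gt0 I0.
have hM : 48 * #|I|%:R * initial_tau R I <= M%:R.
  by rewrite /initial_tau sE ME; exact: initial_size_le.
have sn := trig_bounded_seminorms R Q.
have [xi hxi hdisc] := initial_discretization I0 hq sn (torus_mean_functional R d)
  (@lip_trig_snorm_powR R d Q) (@parseval R d Q) M0 hM.
pose p (j : 'I_M) (x : {ffun I -> R}) := trig_snorm (xi j) x.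
pose l (g : 'I_M * bool) (i : I) : R := trig_functional (xi g.1, g.2) i.
have hp : bounded_seminorms l p.
  split=> [g i|w x|w x y|w c x|w x].
  - exact: entry_le1 sn _ _.
  - exact: snorm_ge0 sn _ _.
  - exact: snormD sn _ _ _.
  - exact: snormZ sn _ _ _.
  - exact: snorm_le sn _ _.
have W0 : (0 < #|'I_M|)%N by rewrite card_ord.
have hK (x : {ffun I -> R}) : \sum_i x i ^+ 2 <= 4 * avg (fun j => p j x ^+ 2).
  have /andP[h _] := hdisc 2 x (or_intror erefl).
  move: h; rewrite (snorm_powR2 sn) (snorm_powR2 hp) parseval; lra.
have [kk hkk hk1] : exists2 kk : nat, 32 * (4 * 4 * s) <= 2 ^+ kk & kk.+1%:R <= 24 * ln s.
  have h : 32 * (4 * 4 * s) <= s ^+ 10.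
    rewrite exprS (_ : 32 * (4 * 4 * s) = s * 512%:R); last by ring.
    by rewrite ler_pM2l //; exact: (@natr_le_expr R s s2 512 9).
  have [|kk h1 h2] := exists_level_count s2 _ h; first by lra.
  by exists kk => //; apply: le_trans h2 _; lra.
have K0 : 0 < 4 :> R by rewrite ltr0n.
have h1 : 32 * (4 * 4 * #|I|%:R) <= (2 : R) ^+ kk by rewrite sE.
have hL : log_card R 'I_M <= 36 * ln s.
  by rewrite /log_card card_ord ME; exact: ln_sample_size_le.
have L0 : 0 <= log_card R 'I_M by rewrite ltW // log_card_gt0.
have h2 : 1000 * (1026 * log_card R 'I_M * (4 * 4 * #|I|%:R) * kk.+1%:R) <= m%:R.
  apply: le_trans hm; rewrite sE ler_pM2l ?ltr0n //.
  have e1 : 1026 * log_card R 'I_M * (4 * 4 * s) <= 1026 * (36 * ln s) * (4 * 4 * s).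
    by rewrite ler_pM2r ?mulr_gt0 ?ltr0n // ler_pM2l ?ltr0n.
  apply: (ler_pM _ (ler0n _ _) e1 hk1).
  by rewrite !mulr_ge0 ?ler0n // ltW.
have [zeta hz] := finite_discretization I0 W0 hq K0 hp hK m0 h1 h2.
exists (fun j => xi (zeta j)); split=> [j|c]; first exact: hxi.
rewrite /Lq_pow; under eq_fun do rewrite cabs_trig_poly.
under eq_bigr do rewrite cabs_trig_poly.
have /andP[z1 z2] := hz (coef_vector Q c).
have /andP[d1 d2] := hdisc q (coef_vector Q c) (or_introl erefl).
move: z1 z2; rewrite /qmean; move: d1 d2.
set u := torus_mean _; set v := avg _; set t := m%:R^-1 * _ => d1 d2 z1 z2.
apply/andP; split; lra.
Qed.

End Assembly.

Local Open Scope fset_scope.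

Theorem theorem4p1 (R : realType) (q : R) (hq : 1 <= q < 2) :
  exists C1 C2 C3 : R, [/\ 0 < C1, 0 < C2 & 0 < C3] /\
    forall (d : nat) (Q : {fset 'rV[int]_d}) (m : nat),
      (0 < #|` Q|)%N ->
      C1 * (#|` Q|)%:R * (ln (2 * (#|` Q|)%:R)) ^+ wexp q <= m%:R ->
      MZ_class Q m q C2 C3.
Proof.
pose A : R := 1000 * (1026 * 36 * (4 * 4 * 2) * 24).
have A0 : 0 < A by rewrite /A; repeat apply: mulr_gt0; rewrite ltr0n.
have hq2 : 1 <= q <= 2 by case/andP: hq => -> /ltW ->.
exists (2 * A), (3200^-1), 1200; split.
  by split; rewrite ?invr_gt0 ?ltr0n // mulr_gt0 // ltr0n.
move=> d Q m Q0 hm; apply: discretization => //; apply: le_trans hm.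
set N : R := (#|` Q|)%:R; set u := ln (2 * N).
have N1 : 1 <= N by rewrite ler1n.
have u2 : 2^-1 <= u.
  apply: le_trans (half_le_ln2 R) _; rewrite ler_ln ?posrE ?ltr0n //; last by apply: mulr_gt0; lra.
  lra.
rewrite (_ : 1000 * _ = A * N * u ^+ 2); last by rewrite /A; ring.
(* For [q = 1] the exponent 3 dominates the exponent 2 up to a factor 2 because [u >= 1/2]; this is
   the 2 in [2 * A]. *)
have hw : u ^+ 2 <= 2 * u ^+ wexp q.
  rewrite /wexp; case: ifP => _; last by rewrite ler_peMl ?sqr_ge0 // ler1n.
  by rewrite [u ^+ 3]exprS mulrA ler_peMl ?sqr_ge0 //; lra.
rewrite (_ : 2 * A * N * _ = A * N * (2 * u ^+ wexp q)); last by ring.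
by apply: ler_wpM2l => //; apply: mulr_ge0; [exact: ltW | exact: ler0n].
Qed.
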